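(* Let $c\in\{-1,0\}$ and let $\eta:\mathbb{R}\to M_c$ be a closed (i.e. periodic), convex curve. For each fixed $\alpha\in(0,\pi/2)$, there exists a unique closed $\alpha$-involutoid associated to $\eta$.
   Context: Space forms: for $c\in\{-1,0\}$ equip $\mathbb{R}^3$ with $\langle x,y\rangle_c=c\,x_1y_1+x_2y_2+x_3y_3$. Let $M_{-1}=\{x:\langle x,x\rangle_{-1}=-1,\ x_1>0\}$ and $M_0=\{x: x_1=0\}$, each with the Riemannian metric induced by $\langle\cdot,\cdot\rangle_c$ (hyperbolic plane of curvature $-1$ and Euclidean plane). Let $\sin_{-1}=\sinh$, $\cos_{-1}=\cosh$, $\sin_0(t)=t$, $\cos_0(t)=1$. For $p\in M_c$, a unit vector $v\in T_pM_c$ and $t\in\mathbb{R}$, $\exp^c_p(tv)=\cos_c(t)\,p+\sin_c(t)\,v$. Frenet frame: for an arc-length parametrized curve $\zeta$ in $M_c$, $\mathbf{t}=\zeta'$ and $\mathbf{e}$ is the unit normal such that $\{\mathbf{t},\mathbf{e}\}$ is a positively oriented orthonormal frame of $M_c$; for $c=-1$, $\mathbf{e}=\zeta\wedge_{-1}\mathbf{t}$ with $x\wedge_{-1}y=(-(x_2y_3-x_3y_2),\,x_3y_1-x_1y_3,\,x_1y_2-x_2y_1)$, and for $c=0$, $\mathbf{e}$ is $\mathbf{t}$ rotated by $+\pi/2$. The geodesic curvature $k$ is defined by $\nabla_{\zeta'}\zeta'=k\,\mathbf{e}$. A smooth, closed, positively oriented, arc-length parametrized curve is called convex if $k(s)>0$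 for all $s$ (when $c=0$) or $k(s)>1$ for all $s$ (when $c=-1$). Evolutoids: for a regular (arc-length parametrized) curve $\zeta:I\to M_c$ and fixed $\alpha$, let $\mathcal{F}_\alpha(s,t)=\exp^c_{\zeta(s)}\big(t(\cos(\alpha)\mathbf{t}(s)+\sin(\alpha)\mathbf{e}(s))\big)$, $s\in I$, $t\in[0,\infty)$. The $\alpha$-evolutoid $\zeta_\alpha$ of $\zeta$ is the envelope of these geodesics, i.e. the image under $\mathcal{F}_\alpha$ of the set of critical points of $\mathcal{F}_\alpha$. Involutoids: an $\alpha$-involutoid associated to a given closed curve $\eta$ in $M_c$ is any regular curve $\zeta:I\subset\mathbb{R}\to M_c$ such that $\zeta_\alpha=\eta$. Curves are identified when they differ by a reparametrization. *)

(* Defs.v *)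
From Stdlib Require Import Reals.
From Coquelicot Require Import Coquelicot.
Open Scope R_scope.

Inductive space_form := hyperbolic | euclidean.

Definition curvature (c : space_form) : R :=
  match c with hyperbolic => -1 | euclidean => 0 end.

(* Coquelicot's product structure on R * R * R supplies the vector space
   operations [plus], [scal] and [zero]. *)
Notation R3 := (R * R * R)%type.

Definition x1 (x : R3) : R := fst (fst x).
Definition x2 (x : R3) : R := snd (fst x).
Definition x3 (x : R3) : R := snd x.

Definition inner (c : space_form) (x y : R3) : R :=
  curvature c * x1 x * x1 y + x2 x * x2 y + x3 x * x3 y.

Definition in_M (c : space_form) (x : R3) : Prop :=
  match c with
  | hyperbolic => inner hyperbolic x x = -1 /\ 0 < x1 x
  | euclidean => x1 x = 0
  end.

Definition sin_c (c : space_form) (t : R) : R :=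
  match c with hyperbolic => sinh t | euclidean => t end.

Definition cos_c (c : space_form) (t : R) : R :=
  match c with hyperbolic => cosh t | euclidean => 1 end.

(* The point exp_p (t v), for a unit vector v tangent at p. *)
Definition exp_M (c : space_form) (p v : R3) (t : R) : R3 :=
  plus (scal (cos_c c t) p) (scal (sin_c c t) v).

Definition wedge (x y : R3) : R3 :=
  (- (x2 x * x3 y - x3 x * x2 y),
   x3 x * x1 y - x1 x * x3 y,
   x1 x * x2 y - x2 x * x1 y).

(* The rotation by +PI/2 of the tangent vector v at p; in the Euclidean case
   the plane {x1 = 0} is oriented by its coordinates (x2, x3). *)
Definition rot (c : space_form) (p v : R3) : R3 :=
  match c with
  | hyperbolic => wedge p v
  | euclidean => (0, - x3 v, x2 v)
  end.

Definition smooth (f : R -> R) : Prop :=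
  forall (n : nat) (s : R), ex_derive_n f n s.

Definition smooth_curve (zeta : R -> R3) : Prop :=
  smooth (fun s => x1 (zeta s)) /\
  smooth (fun s => x2 (zeta s)) /\
  smooth (fun s => x3 (zeta s)).

Definition velocity (zeta : R -> R3) (s : R) : R3 :=
  (Derive (fun u => x1 (zeta u)) s,
   Derive (fun u => x2 (zeta u)) s,
   Derive (fun u => x3 (zeta u)) s).

Definition regular_curve (c : space_form) (zeta : R -> R3) : Prop :=
  smooth_curve zeta /\
  (forall s, in_M c (zeta s)) /\
  (forall s, velocity zeta s <> zero).

Definition closed_curve (zeta : R -> R3) : Prop :=
  exists L : R, 0 < L /\ forall s, zeta (s + L) = zeta s.

Definition arc_length (c : space_form) (zeta : R -> R3) : Prop :=
  forall s, inner c (velocity zeta s) (velocity zeta s) = 1.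

(* The Frenet frame of a regular curve in an arbitrary parametrization, i.e.
   the frame of its orientation-preserving arc-length reparametrization. *)
Definition frenet_t (c : space_form) (zeta : R -> R3) (s : R) : R3 :=
  scal (/ sqrt (inner c (velocity zeta s) (velocity zeta s)))
       (velocity zeta s).

Definition frenet_e (c : space_form) (zeta : R -> R3) (s : R) : R3 :=
  rot c (zeta s) (frenet_t c zeta s).

(* The Levi-Civita connection of M_c is the tangential part of the derivative
   in R^3; the normal line at a point p of the hyperboloid is spanned by p,
   where <p, p> = -1, and the plane M_0 contains the second derivative. *)
Definition covariant_acc (c : space_form) (zeta : R -> R3) (s : R) : R3 :=
  let acc := velocity (velocity zeta) s in
  match c with
  | hyperbolic => plus acc (scal (inner hyperbolic acc (zeta s)) (zeta s))
  | euclidean => acc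
  end.

(* The geodesic curvature of an arc-length parametrized curve. *)
Definition geodesic_curvature (c : space_form) (zeta : R -> R3) (k : R -> R)
    : Prop :=
  forall s, covariant_acc c zeta s = scal (k s) (frenet_e c zeta s).

Definition convex_bound (c : space_form) : R :=
  match c with hyperbolic => 1 | euclidean => 0 end.

(* Positive orientation is not a separate clause: [frenet_e] is the left-hand
   normal, so it is the sign of k that expresses it. Self-intersections are
   allowed. *)
Definition convex_curve (c : space_form) (eta : R -> R3) : Prop :=
  smooth_curve eta /\
  (forall s, in_M c (eta s)) /\
  closed_curve eta /\
  arc_length c eta /\
  exists k : R -> R,
    geodesic_curvature c eta k /\ forall s, convex_bound c < k s.

Definition geodesic_family (c : space_form) (alpha : R) (zeta : R -> R3)
    (s t : R) : R3 :=
  exp_M c (zeta s)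
    (plus (scal (cos alpha) (frenet_t c zeta s))
          (scal (sin alpha) (frenet_e c zeta s))) t.

(* The point (s, t), t >= 0, is critical when the differential
   (a, b) |-> a d_s F + b d_t F of the geodesic family F, with values in the
   2-dimensional tangent space of M_c, has a nontrivial kernel. *)
Definition critical_point (c : space_form) (alpha : R) (zeta : R -> R3)
    (s t : R) : Prop :=
  0 <= t /\
  exists a b : R,
    (a <> 0 \/ b <> 0) /\
    plus (scal a (velocity (fun u => geodesic_family c alpha zeta u t) s))
         (scal b (velocity (fun u => geodesic_family c alpha zeta s u) t))
    = zero.

(* [gamma] is the alpha-evolutoid of [zeta] as a curve: the image of the
   critical points, parametrized by the geodesics of the family, each of which
   carries exactly one critical point. *)
Definition is_evolutoid (c : space_form) (alpha : R) (zeta gamma : R -> R3)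
    : Prop :=
  exists tau : R -> R,
    (forall s t, critical_point c alpha zeta s t <-> t = tau s) /\
    (forall s, gamma s = geodesic_family c alpha zeta s (tau s)).

(* Only orientation-preserving changes of parameter are allowed: reversing a
   curve reverses its frame, hence changes its alpha-evolutoid. *)
Definition reparametrization (zeta1 zeta2 : R -> R3) : Prop :=
  exists h : R -> R,
    smooth h /\
    (forall s, 0 < Derive h s) /\
    (forall u, exists s, h s = u) /\
    (forall s, zeta1 s = zeta2 (h s)).

(* The equality of the alpha-evolutoid of [zeta] with [eta] is an equality of
   curves up to reparametrization, not merely of their traces: a convex curve
   may overlap itself along arcs, and then its trace does not determine it. *)
Definition involutoid (c : space_form) (alpha : R) (eta zeta : R -> R3)
    : Prop :=
  regular_curve c zeta /\
  exists gamma : R -> R3,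
    is_evolutoid c alpha zeta gamma /\ reparametrization gamma eta.

(* Main.v *)
Require Import Defs.
From Stdlib Require Import Reals ZArith Lra Lia FunctionalExtensionality.
From Coquelicot Require Import Coquelicot.
Open Scope R_scope.

(** The whole statement reduces to one scalar differential equation.

    If [eta] is the alpha-evolutoid of [zeta], then each geodesic of the family
    is tangent to [eta] at its critical point, so [zeta] is recovered from
    [eta] by walking backward along the tangent geodesic of [eta] for some
    length [f > 0].  Let [T] be the unit tangent and [w] the geodesic
    curvature of [eta], and [s] its arc length.  The curve
    [exp_eta (- f T)] has velocity [(1 - f') W - w sin_c(f) N], where [W] is
    the direction of the geodesic and [N] its left normal.  That velocity must
    make the angle [- alpha] with [W], which says exactly

      [f' = 1 - cot(alpha) w sin_c(f)]      (the radial equation).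

    Conversely, a positive solution gives a curve with [eta] as its evolutoid
    ([backward_geodesic_involutoid]).  So closed involutoids correspond to
    periodic positive solutions.

    The radial equation is dissipative, because [cot(alpha) w] is bounded below
    by a positive constant (here convexity and periodicity of [eta] enter) and
    [sin_c] increases at least as fast as the identity.  Two solutions
    therefore approach one another exponentially forward in time, hence
    separate exponentially backward, and at most one is bounded on the line
    ([bounded_solution_unique]).  For existence
    ([exists_periodic_solution]), write the equation as [f' = l (Phi(f) - f)]
    with [l] large: a periodic solution is a fixed point of the map which
    sends [f] to the exponentially weighted average of [Phi(f)] over one
    period, and that map is a contraction for the uniform norm.

    The delicate point of the uniqueness part ([involutoid_contact]) is that
    a given involutoid yields a critical length [tau] about which nothing is
    known beforehand.  It is differentiable since [sin_c(tau)] is an inner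
    product of differentiable curves.  The geodesic could touch [eta] with the
    opposite direction; but then [tau + h] would be nonincreasing, [h] being
    the change of parameter, and since [h] is onto the line [tau] would become
    negative.

    All computations are made with moving frames [(p, t, e)] along a curve,
    with [p' = a t + b e].  Turning the frame by a constant angle and sliding it
    along its geodesics by a variable length act on the coefficients by simple
    formulas ([moving_frame_turn], [moving_frame_flow]), uniform in the two
    geometries. *)

(** * Coordinates in R3 *)

Definition lin2 (a : R) (u : R3) (b : R) (v : R3) : R3 :=
  plus (scal a u) (scal b v).

Lemma R3_eq (x y : R3) : x1 x = x1 y -> x2 x = x2 y -> x3 x = x3 y -> x = y.
Proof.
  destruct x as [[? ?] ?], y as [[? ?] ?]; unfold x1, x2, x3; simpl.
  intros; subst; reflexivity.
Qed.

Lemma x1_lin2 a u b v : x1 (lin2 a u b v) = a * x1 u + b * x1 v.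
Proof. reflexivity. Qed.
Lemma x2_lin2 a u b v : x2 (lin2 a u b v) = a * x2 u + b * x2 v.
Proof. reflexivity. Qed.
Lemma x3_lin2 a u b v : x3 (lin2 a u b v) = a * x3 u + b * x3 v.
Proof. reflexivity. Qed.
Lemma x1_wedge u v : x1 (wedge u v) = - (x2 u * x3 v - x3 u * x2 v).
Proof. reflexivity. Qed.
Lemma x2_wedge u v : x2 (wedge u v) = x3 u * x1 v - x1 u * x3 v.
Proof. reflexivity. Qed.
Lemma x3_wedge u v : x3 (wedge u v) = x1 u * x2 v - x2 u * x1 v.
Proof. reflexivity. Qed.

Ltac coords :=
  unfold inner, rot; cbn [curvature];
  repeat (rewrite ?x1_lin2, ?x2_lin2, ?x3_lin2;
    progress rewrite ?x1_wedge, ?x2_wedge, ?x3_wedge);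
  rewrite ?x1_lin2, ?x2_lin2, ?x3_lin2.

Lemma inner_sym c u v : inner c u v = inner c v u.
Proof. unfold inner; ring. Qed.

Lemma inner_lin2_l c a u b v w :
  inner c (lin2 a u b v) w = a * inner c u w + b * inner c v w.
Proof. coords; ring. Qed.

Lemma inner_lin2_r c a u b v w :
  inner c w (lin2 a u b v) = a * inner c w u + b * inner c w v.
Proof. coords; ring. Qed.

Lemma rot_lin2 c p a u b v :
  rot c p (lin2 a u b v) = lin2 a (rot c p u) b (rot c p v).
Proof.
  apply R3_eq; destruct c; coords; unfold x1, x2, x3; simpl; ring.
Qed.

(** * Trigonometric functions of the two space forms *)

Lemma cos_sin_c c t :
  cos_c c t * cos_c c t = 1 - curvature c * (sin_c c t * sin_c c t).
Proof.
  destruct c; simpl; [ | ring].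
  unfold cosh, sinh.
  assert (E : exp t * exp (- t) = 1)
    by (rewrite <- exp_plus, Rplus_opp_r; apply exp_0).
  nra.
Qed.

Lemma sin_c_0 c : sin_c c 0 = 0.
Proof. destruct c; simpl; [apply sinh_0 | reflexivity]. Qed.

Lemma sin_c_opp c t : sin_c c (- t) = - sin_c c t.
Proof.
  destruct c; simpl; [ | reflexivity]. unfold sinh; rewrite Ropp_involutive; lra.
Qed.

Lemma cos_c_opp c t : cos_c c (- t) = cos_c c t.
Proof.
  destruct c; simpl; [ | reflexivity]. unfold cosh; rewrite Ropp_involutive; lra.
Qed.

Lemma is_derive_sin_c c t : is_derive (sin_c c) t (cos_c c t).
Proof.
  destruct c; simpl.
  - apply is_derive_Reals, derivable_pt_lim_sinh.
  - apply (is_derive_id t).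
Qed.

Lemma is_derive_cos_c c t :
  is_derive (cos_c c) t (- curvature c * sin_c c t).
Proof.
  destruct c; simpl.
  - replace (- -1 * sinh t) with (sinh t) by ring.
    apply is_derive_Reals, derivable_pt_lim_cosh.
  - replace (- 0 * t) with 0 by ring. apply (is_derive_const 1 t).
Qed.

Lemma cos_c_ge_1 c t : 1 <= cos_c c t.
Proof.
  destruct c; simpl; [ | lra]. unfold cosh.
  assert (E : exp t * exp (- t) = 1)
    by (rewrite <- exp_plus, Rplus_opp_r; apply exp_0).
  pose proof (exp_pos t); pose proof (exp_pos (- t)).
  set (a := exp t) in *; set (b := exp (- t)) in *.
  assert (0 <= (a - b) * (a - b)) by apply Rle_0_sqr.
  assert (2 <= a + b); [ | lra].
  destruct (Rle_dec 2 (a + b)); [assumption | exfalso; nra].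
Qed.

Lemma mean_value (f f' : R -> R) x y :
  (forall z, is_derive f z (f' z)) ->
  exists z, Rmin x y <= z <= Rmax x y /\ f y - f x = f' z * (y - x).
Proof.
  intros H. apply MVT_gen; [intros; apply H | ].
  intros z _. apply continuity_pt_filterlim, (ex_derive_continuous f z).
  eexists; apply H.
Qed.
(** [cos_c >= 1]; this expansion is what makes the radial equation dissipative. *)
Lemma sin_c_expand c x y : x <= y -> y - x <= sin_c c y - sin_c c x.
Proof.
  intros Hxy.
  destruct (mean_value _ _ x y (is_derive_sin_c c)) as [z [_ Hz]].
  rewrite Hz. pose proof (cos_c_ge_1 c z). nra.
Qed.

Lemma sin_c_pos c x : 0 < x -> 0 < sin_c c x.
Proof.
  intros Hx. pose proof (sin_c_expand c 0 x). rewrite sin_c_0 in H. lra.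
Qed.

Lemma cos_c_incr c x y : 0 <= x -> x <= y -> cos_c c x <= cos_c c y.
Proof.
  intros Hx Hy. pose proof (cos_sin_c c x). pose proof (cos_sin_c c y).
  pose proof (cos_c_ge_1 c x). pose proof (cos_c_ge_1 c y).
  pose proof (sin_c_expand c x y Hy). pose proof (sin_c_expand c 0 x Hx).
  rewrite sin_c_0 in *. 
  destruct c; simpl in *; [nra | lra].
Qed.

Lemma sin_c_lipschitz c m x y :
  0 <= x -> x <= y -> y <= m -> sin_c c y - sin_c c x <= cos_c c m * (y - x).
Proof.
  intros Hx Hxy Hm.
  destruct (mean_value _ _ x y (is_derive_sin_c c)) as [z [Hz1 Hz]].
  rewrite Hz. rewrite Rmin_left, Rmax_right in Hz1 by lra.
  pose proof (cos_c_incr c z m). apply Rmult_le_compat_r; [lra | apply H; lra].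
Qed.

(** Injectivity of [tan_c = sin_c / cos_c], without division: it is why a geodesic
    carries at most one critical point. *)
Lemma tan_c_inj c x y :
  sin_c c x * cos_c c y = cos_c c x * sin_c c y -> x = y.
Proof.
  intros H.
  pose proof (cos_sin_c c x). pose proof (cos_sin_c c y).
  pose proof (cos_c_ge_1 c x). pose proof (cos_c_ge_1 c y).
  assert (sin_c c x = sin_c c y).
  { destruct c; simpl in *; [ | lra].
    assert (S : sinh x * sinh x = sinh y * sinh y).
    { assert (sinh x * cosh y * (sinh x * cosh y) = cosh x * sinh y * (cosh x * sinh y))
        by (rewrite H; ring). nra. }
    assert (cosh x = cosh y) by nra. rewrite H4 in H. nra. }
  pose proof (sin_c_expand c x y). pose proof (sin_c_expand c y x).
  destruct (Rle_dec x y); lra.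
Qed.

(** * Unit tangent vectors, their turning and their geodesic flow *)

(** The tangent space of [M_c] at [p] as a linear subspace of R3. *)
Definition tangent (c : space_form) (p v : R3) : Prop :=
  match c with hyperbolic => inner c p v = 0 | euclidean => x1 v = 0 end.

Definition unit_tangent c p v :=
  in_M c p /\ tangent c p v /\ inner c v v = 1.

Definition turn c p v th := lin2 (cos th) v (sin th) (rot c p v).

(** The velocity at time [t] of the geodesic [exp_M c p v]: it is the derivative
    of [exp_M], as [cos_c' = - curvature c * sin_c]. *)
Definition geo_vel c p v t :=
  lin2 (cos_c c t) v (- curvature c * sin_c c t) p.

Lemma tangent_lin2 c p a u b v :
  tangent c p u -> tangent c p v -> tangent c p (lin2 a u b v).
Proof.
  destruct c; simpl; intros Hu Hv.
  - rewrite inner_lin2_r, Hu, Hv; ring.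
  - rewrite x1_lin2, Hu, Hv; ring.
Qed.

Lemma unit_tangent_rot c p v :
  unit_tangent c p v -> unit_tangent c p (rot c p v).
Proof.
  intros (Hp & Ht & Hu); split; [exact Hp | ].
  destruct c; simpl in *.
  - destruct Hp as [Hp _]. split; [coords; ring | ].
    assert (E : inner hyperbolic (wedge p v) (wedge p v)
      = inner hyperbolic p v * inner hyperbolic p v
        - inner hyperbolic p p * inner hyperbolic v v) by (coords; ring).
    rewrite E, Hp, Ht, Hu; ring.
  - split; [reflexivity | ].
    rewrite <- Hu. unfold inner, x1, x2, x3; simpl. ring.
Qed.

Lemma inner_rot c p v : inner c v (rot c p v) = 0.
Proof. destruct c; unfold inner, rot, wedge, x1, x2, x3; simpl; ring. Qed.

(** On the tangent plane [rot] is a rotation by a right angle, so its square is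
    [-1]. *)
Lemma rot_rot c p v :
  unit_tangent c p v -> rot c p (rot c p v) = lin2 (- 1) v 0 p.
Proof.
  intros (Hp & Ht & _). destruct c; simpl in *.
  - destruct Hp as [Hp _].
    assert (E : wedge p (wedge p v)
      = lin2 (inner hyperbolic p p) v (- inner hyperbolic p v) p)
      by (apply R3_eq; coords; ring).
    rewrite E, Hp, Ht, Ropp_0; reflexivity.
  - apply R3_eq; coords; unfold x1, x2, x3 in *; simpl in *; rewrite ?Ht; ring.
Qed.

Lemma sin2_cos th : sin th * sin th = 1 - cos th * cos th.
Proof. pose proof (sin2_cos2 th). unfold Rsqr in H. lra. Qed.

Lemma unit_tangent_turn c p v th :
  unit_tangent c p v -> unit_tangent c p (turn c p v th).
Proof.
  intros H. pose proof (unit_tangent_rot _ _ _ H) as H'.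
  destruct H as (Hp & Ht & Hu), H' as (_ & Ht' & Hu').
  split; [exact Hp | split; [apply tangent_lin2; assumption | ]].
  unfold turn. rewrite inner_lin2_l, !inner_lin2_r, Hu, Hu'.
  rewrite (inner_sym c (rot c p v) v), inner_rot.
  ring [(sin2_cos th)].
Qed.

Lemma rot_turn c p v th :
  unit_tangent c p v ->
  rot c p (turn c p v th) = lin2 (- sin th) v (cos th) (rot c p v).
Proof.
  intros H. unfold turn. rewrite rot_lin2, (rot_rot _ _ _ H).
  apply R3_eq; coords; ring.
Qed.

Lemma turn_turn c p v th :
  unit_tangent c p v -> turn c p (turn c p v th) (- th) = v.
Proof.
  intros H. unfold turn at 1. rewrite (rot_turn _ _ _ _ H), cos_neg, sin_neg.
  unfold turn. pose proof (sin2_cos th).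
  apply R3_eq; coords; ring [H0].
Qed.

Lemma unit_tangent_flow c p v t :
  unit_tangent c p v -> unit_tangent c (exp_M c p v t) (geo_vel c p v t).
Proof.
  intros (Hp & Ht & Hu). pose proof (cos_sin_c c t) as E.
  change (exp_M c p v t) with (lin2 (cos_c c t) p (sin_c c t) v).
  unfold geo_vel.
  destruct c; cbn [cos_c sin_c in_M tangent curvature] in *;
    unfold unit_tangent; cbn [in_M tangent].
  - destruct Hp as [Hp Hp1].
    rewrite !inner_lin2_l, !inner_lin2_r, (inner_sym _ v p), Hp, Ht, Hu.
    repeat split; try ring [E].
    rewrite x1_lin2.
    (* By Cauchy-Schwarz, |x1 v| < x1 p; as |sinh| < cosh, the first coordinate
       of the carried point stays positive. *)
    unfold inner in Hp, Ht, Hu; cbn [curvature] in *.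
    assert (B : x1 v * x1 v < x1 p * x1 p).
    { assert (x1 p * x1 v = x2 p * x2 v + x3 p * x3 v) by lra.
      assert (0 <= (x2 p * x3 v - x3 p * x2 v) * (x2 p * x3 v - x3 p * x2 v))
        by (apply Rle_0_sqr).
      assert ((x1 p * x1 v) * (x1 p * x1 v)
        <= (x2 p * x2 p + x3 p * x3 p) * (x2 v * x2 v + x3 v * x3 v))
        by (rewrite H; nra).
      replace (x2 p * x2 p + x3 p * x3 p) with (x1 p * x1 p - 1) in H1 by lra.
      replace (x2 v * x2 v + x3 v * x3 v) with (x1 v * x1 v + 1) in H1 by lra.
      nra. }
    pose proof (cos_c_ge_1 hyperbolic t) as C; simpl in C.
    assert (B' : (sinh t * x1 v) * (sinh t * x1 v)
                 < (cosh t * x1 p) * (cosh t * x1 p)).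
    { replace (cosh t * x1 p * (cosh t * x1 p))
        with (cosh t * cosh t * (x1 p * x1 p)) by ring.
      rewrite E. pose proof (Rle_0_sqr (sinh t)). unfold Rsqr in *. nra. }
    assert (0 < cosh t * x1 p) by nra.
    nra.
  - rewrite !x1_lin2, Hp, Ht, !inner_lin2_l, !inner_lin2_r, Hu.
    repeat split; ring.
Qed.

Lemma exp_flow_back c p v t :
  exp_M c (exp_M c p v t) (geo_vel c p v t) (- t) = p.
Proof.
  unfold exp_M, geo_vel. rewrite cos_c_opp, sin_c_opp.
  pose proof (cos_sin_c c t) as E.
  fold (lin2 (cos_c c t) p (sin_c c t) v).
  match goal with |- plus (scal ?a ?u) (scal ?b ?v) = _ => fold (lin2 a u b v) end.
  apply R3_eq; coords; ring [E].
Qed.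

Lemma geo_vel_flow_back c p v t :
  geo_vel c (exp_M c p v t) (geo_vel c p v t) (- t) = v.
Proof.
  change (exp_M c p v t) with (lin2 (cos_c c t) p (sin_c c t) v).
  unfold geo_vel. rewrite cos_c_opp, sin_c_opp.
  pose proof (cos_sin_c c t) as E. apply R3_eq; coords; ring [E].
Qed.

(** The normal of a geodesic is parallel along it, and in both models a parallel
    normal field is constant in R3. *)
Lemma rot_flow c p v t :
  rot c (exp_M c p v t) (geo_vel c p v t) = rot c p v.
Proof.
  change (exp_M c p v t) with (lin2 (cos_c c t) p (sin_c c t) v).
  unfold geo_vel. pose proof (cos_sin_c c t) as E.
  destruct c; cbn [curvature cos_c sin_c] in *.
  - apply R3_eq; coords; ring [E].
  - apply R3_eq; unfold rot; rewrite ?x2_lin2, ?x3_lin2; unfold x1, x2, x3; simpl; ring.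
Qed.

(** [v] and [rot c p v] are orthonormal, hence independent. *)
Lemma lin2_inj c p v a b a' b' :
  unit_tangent c p v ->
  lin2 a v b (rot c p v) = lin2 a' v b' (rot c p v) -> a = a' /\ b = b'.
Proof.
  intros H E. pose proof (unit_tangent_rot _ _ _ H) as (_ & _ & Hu').
  destruct H as (_ & _ & Hu). split.
  - apply (f_equal (fun x => inner c x v)) in E.
    rewrite !inner_lin2_l, Hu, (inner_sym c (rot c p v)), inner_rot in E. lra.
  - apply (f_equal (fun x => inner c x (rot c p v))) in E.
    rewrite !inner_lin2_l, Hu', inner_rot in E. lra.
Qed.

(** * Differentiation of curves in R3 *)

Definition is_velocity (z : R -> R3) (s : R) (v : R3) : Prop :=
  is_derive (fun u => x1 (z u)) s (x1 v) /\
  is_derive (fun u => x2 (z u)) s (x2 v) /\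
  is_derive (fun u => x3 (z u)) s (x3 v).

Lemma is_velocity_unique z s v : is_velocity z s v -> velocity z s = v.
Proof.
  intros (H1 & H2 & H3).
  apply R3_eq; apply is_derive_unique; assumption.
Qed.

Lemma is_derive_eq (f : R -> R) (s l l' : R) : l = l' -> is_derive f s l -> is_derive f s l'.
Proof. intros ->; auto. Qed.

Lemma is_derive_Rmult (f g : R -> R) s f' g' :
  is_derive f s f' -> is_derive g s g' ->
  is_derive (fun u => f u * g u) s (f' * g s + f s * g').
Proof.
  intros Hf Hg. apply (is_derive_mult f g s f' g' Hf Hg). intros; apply Rmult_comm.
Qed.

Lemma is_derive_Rcomp (f g : R -> R) s f' g' :
  is_derive f (g s) f' -> is_derive g s g' ->
  is_derive (fun u => f (g u)) s (f' * g').
Proof.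
  intros Hf Hg. replace (f' * g') with (g' * f') by ring.
  apply (is_derive_comp f g s f' g' Hf Hg).
Qed.

Lemma is_velocity_lin2 a a' u u' b b' v v' s :
  is_derive a s a' -> is_velocity u s u' ->
  is_derive b s b' -> is_velocity v s v' ->
  is_velocity (fun r => lin2 (a r) (u r) (b r) (v r)) s
    (plus (lin2 a' (u s) (a s) u') (lin2 b' (v s) (b s) v')).
Proof.
  intros Ha (Hu1 & Hu2 & Hu3) Hb (Hv1 & Hv2 & Hv3).
  split; [ | split];
    (apply (is_derive_plus (V := R_NormedModule)); apply is_derive_Rmult; assumption).
Qed.

Lemma is_velocity_comp z h s v h' :
  is_velocity z (h s) v -> is_derive h s h' ->
  is_velocity (fun u => z (h u)) s (scal h' v).
Proof.
  intros (H1 & H2 & H3) Hh.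
  split; [ | split].
  - apply (is_derive_comp (fun u => x1 (z u)) h s (x1 v) h'); assumption.
  - apply (is_derive_comp (fun u => x2 (z u)) h s (x2 v) h'); assumption.
  - apply (is_derive_comp (fun u => x3 (z u)) h s (x3 v) h'); assumption.
Qed.

Lemma is_derive_inner c u v s u' v' :
  is_velocity u s u' -> is_velocity v s v' ->
  is_derive (fun r => inner c (u r) (v r)) s
    (inner c u' (v s) + inner c (u s) v').
Proof.
  intros (Hu1 & Hu2 & Hu3) (Hv1 & Hv2 & Hv3). unfold inner.
  eapply is_derive_eq; [ | apply (is_derive_plus (V := R_NormedModule));
    [apply (is_derive_plus (V := R_NormedModule)) | ];
    apply is_derive_Rmult; [ apply is_derive_Rmult;
      [apply (is_derive_const (V := R_NormedModule)) | ] | | | | | ]; eassumption ].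
  unfold plus, zero; simpl. ring.
Qed.

Lemma is_velocity_wedge u v s u' v' :
  is_velocity u s u' -> is_velocity v s v' ->
  is_velocity (fun r => wedge (u r) (v r)) s
    (plus (wedge u' (v s)) (wedge (u s) v')).
Proof.
  intros (Hu1 & Hu2 & Hu3) (Hv1 & Hv2 & Hv3).
  split; [ | split].
  - eapply is_derive_eq; [ | apply (is_derive_opp (V := R_NormedModule)),
      (is_derive_minus (V := R_NormedModule)); apply is_derive_Rmult; eassumption].
    unfold x1 at 1; unfold opp, minus, plus, opp; simpl; unfold plus, x1, x2, x3; simpl; ring.
  - eapply is_derive_eq; [ | apply (is_derive_minus (V := R_NormedModule));
      apply is_derive_Rmult; eassumption].
    unfold x2 at 1; unfold opp, minus, plus, opp; simpl; unfold plus, x1, x2, x3; simpl; ring.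
  - eapply is_derive_eq; [ | apply (is_derive_minus (V := R_NormedModule));
      apply is_derive_Rmult; eassumption].
    unfold x3 at 1; unfold opp, minus, plus, opp; simpl; unfold plus, x1, x2, x3; simpl; ring.
Qed.

(** * Adapted moving frames *)

(** The structure equations of an orthonormal frame [(t, e)] of [M_c] along the
    curve [p], seen in R3: [(a, b)] is the velocity of [p] in the frame and [w] the
    turning rate of the frame. The terms in [p] are the normal components that
    the hyperboloid imposes. *)
Definition moving_frame c (p t e : R -> R3) (s a b w : R) : Prop :=
  is_velocity p s (lin2 a (t s) b (e s)) /\
  is_velocity t s (lin2 w (e s) (- curvature c * a) (p s)) /\
  is_velocity e s (lin2 (- w) (t s) (- curvature c * b) (p s)).

Lemma is_velocity_ext z s v v' : v = v' -> is_velocity z s v -> is_velocity z s v'.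
Proof. intros ->; auto. Qed.

Ltac vec_eq :=
  apply R3_eq;
  match goal with
  | |- ?f (plus ?u ?v) = _ => change (f (plus u v)) with (f u + f v)
  | |- ?f (scal ?u ?v) = _ => change (f (scal u v)) with (u * f v)
  | |- _ => idtac
  end;
  rewrite ?x1_lin2, ?x2_lin2, ?x3_lin2;
  rewrite ?x1_lin2, ?x2_lin2, ?x3_lin2.

(** Each point of the frame is carried along its own geodesic by the length [r].
    The new normal velocity [b cos_c r + w sin_c r] is the Jacobi field of the
    geodesic variation; [e] is unchanged since it is parallel. *)
Lemma moving_frame_flow c p t e r r' s a b w :
  moving_frame c p t e s a b w -> is_derive r s r' ->
  moving_frame c (fun u => exp_M c (p u) (t u) (r u))
    (fun u => geo_vel c (p u) (t u) (r u)) e s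
    (a + r') (b * cos_c c (r s) + w * sin_c c (r s))
    (w * cos_c c (r s) - curvature c * b * sin_c c (r s)).
Proof.
  intros (Hp & Ht & He) Hr.
  pose proof (is_derive_Rcomp _ r s _ _ (is_derive_sin_c c (r s)) Hr) as Hsin.
  pose proof (is_derive_Rcomp _ r s _ _ (is_derive_cos_c c (r s)) Hr) as Hcos.
  pose proof (cos_sin_c c (r s)) as E.
  split; [ | split].
  - eapply is_velocity_ext;
      [ | exact (is_velocity_lin2 _ _ _ _ _ _ _ _ _ Hcos Hp Hsin Ht)].
    unfold geo_vel. vec_eq; ring.
  - eapply is_velocity_ext;
      [ | refine (is_velocity_lin2 _ _ _ _ _ _ _ _ _ Hcos Ht _ Hp);
          apply (is_derive_scal (fun u => sin_c c (r u)) s (- curvature c)), Hsin].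
    change (exp_M c (p s) (t s) (r s))
      with (lin2 (cos_c c (r s)) (p s) (sin_c c (r s)) (t s)).
    vec_eq; ring [E].
  - eapply is_velocity_ext; [ | exact He].
    change (exp_M c (p s) (t s) (r s))
      with (lin2 (cos_c c (r s)) (p s) (sin_c c (r s)) (t s)).
    unfold geo_vel. vec_eq; ring [E].
Qed.

Lemma moving_frame_turn c p t e th s a b w :
  moving_frame c p t e s a b w ->
  moving_frame c p (fun u => lin2 (cos th) (t u) (sin th) (e u))
    (fun u => lin2 (- sin th) (t u) (cos th) (e u)) s
    (a * cos th + b * sin th) (b * cos th - a * sin th) w.
Proof.
  intros (Hp & Ht & He). pose proof (sin2_cos th) as E.
  assert (K : forall x : R, is_derive (fun _ : R => x) s 0)
    by (intros x; apply (is_derive_const (V := R_NormedModule))).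
  split; [ | split].
  - eapply is_velocity_ext; [ | exact Hp]. vec_eq; ring [E].
  - eapply is_velocity_ext;
      [ | exact (is_velocity_lin2 _ _ _ _ _ _ _ _ _ (K (cos th)) Ht (K (sin th)) He)].
    vec_eq; ring [E].
  - eapply is_velocity_ext;
      [ | exact (is_velocity_lin2 _ _ _ _ _ _ _ _ _ (K (- sin th)) Ht (K (cos th)) He)].
    vec_eq; ring [E].
Qed.

Lemma moving_frame_comp c p t e h h' s a b w :
  moving_frame c p t e (h s) a b w -> is_derive h s h' ->
  moving_frame c (fun u => p (h u)) (fun u => t (h u)) (fun u => e (h u)) s
    (h' * a) (h' * b) (h' * w).
Proof.
  intros (Hp & Ht & He) Hh.
  split; [ | split]; eapply is_velocity_ext;
    [ | apply is_velocity_comp; eassumption | | apply is_velocity_comp; eassumption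
      | | apply is_velocity_comp; eassumption ]; vec_eq; ring.
Qed.

Lemma is_velocity_geodesic c p v t :
  is_velocity (fun u => exp_M c p v u) t (geo_vel c p v t).
Proof.
  assert (K : forall x : R3, is_velocity (fun _ => x) t zero)
    by (intros x; split; [ | split]; apply (is_derive_const (V := R_NormedModule))).
  eapply is_velocity_ext;
    [ | exact (is_velocity_lin2 _ _ _ _ _ _ _ _ _ (is_derive_cos_c c t) (K p)
        (is_derive_sin_c c t) (K v))].
  unfold geo_vel. vec_eq; unfold zero, x1, x2, x3; simpl; unfold zero; simpl; ring.
Qed.

Lemma lin2_combine a x g y n b :
  plus (scal a (lin2 x g y n)) (scal b g) = lin2 (a * x + b) g (a * y) n.
Proof.
  change (lin2 a (lin2 x g y n) b g = lin2 (a * x + b) g (a * y) n). vec_eq; ring.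
Qed.

Lemma lin2_eq_0 c p v a b :
  unit_tangent c p v -> lin2 a v b (rot c p v) = zero -> a = 0 /\ b = 0.
Proof.
  intros H E. apply (lin2_inj c p v); [exact H | ]. rewrite E.
  apply R3_eq; rewrite ?x1_lin2, ?x2_lin2, ?x3_lin2, !Rmult_0_l, Rplus_0_l; reflexivity.
Qed.

(** * Critical points of a geodesic family *)

(** The family of geodesics is the Frenet frame turned by [alpha] and carried by
    the constant length [t]. Its derivative in [t] is the geodesic velocity, so
    the differential degenerates exactly when the normal velocity, a Jacobi
    field, vanishes. *)
Lemma critical_point_iff c alpha zeta s t v w :
  (forall u, unit_tangent c (zeta u) (frenet_t c zeta u)) ->
  moving_frame c zeta (frenet_t c zeta) (frenet_e c zeta) s v 0 w ->
  critical_point c alpha zeta s t <->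
  0 <= t /\ w * sin_c c t = v * sin alpha * cos_c c t.
Proof.
  intros Hu Hm.
  set (d := fun u => turn c (zeta u) (frenet_t c zeta u) alpha).
  set (n := rot c (zeta s) (d s)).
  assert (Hd : forall u, unit_tangent c (zeta u) (d u))
    by exact (fun u => unit_tangent_turn c _ _ alpha (Hu u)).
  assert (Hf : unit_tangent c (exp_M c (zeta s) (d s) t) (geo_vel c (zeta s) (d s) t))
    by exact (unit_tangent_flow c _ _ t (Hd s)).
  assert (Hs : velocity (fun u => geodesic_family c alpha zeta u t) s
    = lin2 (v * cos alpha) (geo_vel c (zeta s) (d s) t)
        (w * sin_c c t - v * sin alpha * cos_c c t) n).
  { pose proof (moving_frame_flow c _ _ _ (fun _ => t) 0 s _ _ _
      (moving_frame_turn c _ _ _ alpha s _ _ _ Hm)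
      (is_derive_const (V := R_NormedModule) t s)) as (Hp & _ & _).
    etransitivity; [exact (is_velocity_unique _ _ _ Hp) | ]. unfold n, d.
    rewrite (rot_turn _ _ _ _ (Hu s)). unfold frenet_e, turn. f_equal; ring. }
  assert (Ht : velocity (fun u => geodesic_family c alpha zeta s u) t
    = geo_vel c (zeta s) (d s) t)
    by (apply is_velocity_unique, is_velocity_geodesic).
  unfold critical_point. rewrite Hs, Ht.
  set (g := geo_vel c (zeta s) (d s) t) in *.
  assert (Hn : n = rot c (exp_M c (zeta s) (d s) t) g)
    by (symmetry; apply rot_flow).
  split.
  - intros (H0 & a & b & Hab & E). split; [exact H0 | ].
    rewrite lin2_combine, Hn in E.
    apply (lin2_eq_0 _ _ _ _ _ Hf) in E. destruct E as [E1 E2].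
    assert (a <> 0) by (intros ->; destruct Hab as [Hab | Hab]; lra).
    apply Rmult_integral in E2. lra.
  - intros (H0 & E). split; [exact H0 | ].
    exists 1, (- (v * cos alpha)). split; [left; lra | ].
    rewrite lin2_combine, Hn, E. apply R3_eq; rewrite ?x1_lin2, ?x2_lin2, ?x3_lin2;
      match goal with |- _ = ?z => change z with 0 end; ring.
Qed.

(** * Smooth functions *)

(** Iterated differentiability by recursion on the first derivative, the form in
    which sums, products and compositions are handled by induction. *)
Fixpoint diff_n (n : nat) (f : R -> R) : Prop :=
  match n with
  | O => True
  | S m => (forall s, ex_derive f s) /\ diff_n m (Derive f)
  end.

Lemma Derive_n_Derive f n s : Derive_n (Derive f) n s = Derive_n f (S n) s.
Proof.
  change (Derive f) with (Derive_n f 1). rewrite Derive_n_comp.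
  f_equal; lia.
Qed.

Lemma smooth_Derive f : smooth f -> smooth (Derive f).
Proof.
  intros H [ | n] s; [exact I | ]. simpl.
  apply ex_derive_ext with (Derive_n f (S n)).
  - intros; symmetry; apply Derive_n_Derive.
  - exact (H (S (S n)) s).
Qed.

Lemma smooth_diff_n f : smooth f <-> forall n, diff_n n f.
Proof.
  split.
  - intros H n; revert f H; induction n as [ | n IH]; intros f H; [exact I | ].
    split; [exact (H 1%nat) | apply IH, smooth_Derive, H].
  - intros H n; revert f H; induction n as [ | n IH]; intros f H s; [exact I | ].
    destruct n as [ | n]; [apply (H 1%nat) | ].
    simpl. apply ex_derive_ext with (Derive_n (Derive f) n).
    + intros; apply Derive_n_Derive.
    + apply (IH (Derive f)). intros m. apply (H (S m)).
Qed.

Lemma diff_n_S n f : diff_n (S n) f -> diff_n n f.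
Proof.
  revert f; induction n as [ | n IH]; intros f [H1 H2]; [exact I | ].
  split; [exact H1 | apply IH, H2].
Qed.

Lemma diff_n_of_derive n (f f' : R -> R) :
  (forall s, is_derive f s (f' s)) -> diff_n n f' -> diff_n (S n) f.
Proof.
  intros H H'; split.
  - intros s; eexists; apply H.
  - replace (Derive f) with f'; [exact H' | ].
    apply functional_extensionality; intros s; symmetry; apply is_derive_unique, H.
Qed.

Lemma diff_n_is_derive n f :
  diff_n (S n) f -> forall s, is_derive f s (Derive f s).
Proof. intros [H _] s; apply Derive_correct, H. Qed.

Lemma diff_n_const n (a : R) : diff_n n (fun _ => a).
Proof.
  revert a; induction n as [ | n IH]; intros a; [exact I | ].
  apply diff_n_of_derive with (fun _ => 0); [ | apply IH].
  intros s; apply (is_derive_const (V := R_NormedModule)).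
Qed.

Lemma diff_n_id n : diff_n n (fun s => s).
Proof.
  destruct n as [ | n]; [exact I | ].
  apply diff_n_of_derive with (fun _ => 1); [ | apply diff_n_const].
  intros s; apply (is_derive_id s).
Qed.

Lemma diff_n_plus n f g : diff_n n f -> diff_n n g -> diff_n n (fun s => f s + g s).
Proof.
  revert f g; induction n as [ | n IH]; intros f g Hf Hg; [exact I | ].
  apply diff_n_of_derive with (fun s => Derive f s + Derive g s).
  - intros s; apply (is_derive_plus (V := R_NormedModule));
      eapply diff_n_is_derive; eassumption.
  - apply IH; [apply Hf | apply Hg].
Qed.

Lemma diff_n_mult n f g : diff_n n f -> diff_n n g -> diff_n n (fun s => f s * g s).
Proof.
  revert f g; induction n as [ | n IH]; intros f g Hf Hg; [exact I | ].
  apply diff_n_of_derive with (fun s => Derive f s * g s + f s * Derive g s).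
  - intros s; apply is_derive_Rmult; eapply diff_n_is_derive; eassumption.
  - pose proof (diff_n_S _ _ Hf). pose proof (diff_n_S _ _ Hg).
    apply diff_n_plus; apply IH; (assumption || apply Hf || apply Hg).
Qed.

Lemma diff_n_comp n f g : diff_n n f -> diff_n n g -> diff_n n (fun s => f (g s)).
Proof.
  revert f g; induction n as [ | n IH]; intros f g Hf Hg; [exact I | ].
  apply diff_n_of_derive with (fun s => Derive f (g s) * Derive g s).
  - intros s; apply is_derive_Rcomp; eapply diff_n_is_derive; eassumption.
  - apply diff_n_mult; [apply IH | ]; [apply Hf | apply diff_n_S, Hg | apply Hg].
Qed.

Lemma diff_n_sin_cos_c c n : diff_n n (sin_c c) /\ diff_n n (cos_c c).
Proof.
  induction n as [ | n [IH1 IH2]]; [split; exact I | split].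
  - apply diff_n_of_derive with (cos_c c); [apply is_derive_sin_c | exact IH2].
  - apply diff_n_of_derive with (fun t => - curvature c * sin_c c t);
      [apply is_derive_cos_c | apply diff_n_mult; [apply diff_n_const | exact IH1]].
Qed.

Lemma smooth_const (a : R) : smooth (fun _ => a).
Proof. apply smooth_diff_n; intros; apply diff_n_const. Qed.

Lemma smooth_id : smooth (fun s => s).
Proof. apply smooth_diff_n; intros; apply diff_n_id. Qed.

Lemma smooth_plus f g : smooth f -> smooth g -> smooth (fun s => f s + g s).
Proof. rewrite !smooth_diff_n; intros; apply diff_n_plus; auto. Qed.

Lemma smooth_mult f g : smooth f -> smooth g -> smooth (fun s => f s * g s).
Proof. rewrite !smooth_diff_n; intros; apply diff_n_mult; auto. Qed.

Lemma smooth_comp f g : smooth f -> smooth g -> smooth (fun s => f (g s)).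
Proof. rewrite !smooth_diff_n; intros; apply diff_n_comp; auto. Qed.

Lemma smooth_sin_c c : smooth (sin_c c).
Proof. apply smooth_diff_n; intros; apply diff_n_sin_cos_c. Qed.

Lemma smooth_cos_c c : smooth (cos_c c).
Proof. apply smooth_diff_n; intros; apply diff_n_sin_cos_c. Qed.

(** Bootstrapping: the equation makes [f'] as differentiable as [f]. *)
Lemma smooth_ode c (q f : R -> R) :
  smooth q -> (forall s, is_derive f s (1 - q s * sin_c c (f s))) -> smooth f.
Proof.
  rewrite !smooth_diff_n. intros Hq Hf n. induction n as [ | n IH]; [exact I | ].
  apply diff_n_of_derive with (fun s => 1 + (- 1 * q s) * sin_c c (f s)).
  - intros s. eapply is_derive_eq; [ | apply Hf]. ring.
  - apply diff_n_plus; [apply diff_n_const | ].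
    apply diff_n_mult; [apply diff_n_mult; [apply diff_n_const | apply Hq] | ].
    apply diff_n_comp; [apply diff_n_sin_cos_c | exact IH].
Qed.

Lemma smooth_is_derive f : smooth f -> forall s, is_derive f s (Derive f s).
Proof. intros H s; apply Derive_correct, (H 1%nat s). Qed.

Lemma smooth_curve_velocity z : smooth_curve z -> smooth_curve (velocity z).
Proof. intros (H1 & H2 & H3); split; [ | split]; apply smooth_Derive; assumption. Qed.

Lemma smooth_curve_is_velocity z :
  smooth_curve z -> forall s, is_velocity z s (velocity z s).
Proof.
  intros (H1 & H2 & H3) s; split; [ | split]; apply smooth_is_derive; assumption.
Qed.

Lemma smooth_curve_lin2 a u b v :
  smooth a -> smooth_curve u -> smooth b -> smooth_curve v ->
  smooth_curve (fun s => lin2 (a s) (u s) (b s) (v s)).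
Proof.
  intros Ha (Hu1 & Hu2 & Hu3) Hb (Hv1 & Hv2 & Hv3); split; [ | split];
    apply smooth_plus; apply smooth_mult; assumption.
Qed.

Lemma smooth_inner c u v :
  smooth_curve u -> smooth_curve v -> smooth (fun s => inner c (u s) (v s)).
Proof.
  intros (Hu1 & Hu2 & Hu3) (Hv1 & Hv2 & Hv3).
  unfold inner. apply smooth_plus; [apply smooth_plus | ]; apply smooth_mult;
    [apply smooth_mult; [apply smooth_const | ] | | | | | ]; assumption.
Qed.

Lemma smooth_opp f : smooth f -> smooth (fun s => - f s).
Proof.
  intros H. replace (fun s => - f s) with (fun s => - 1 * f s)
    by (apply functional_extensionality; intros; ring).
  apply smooth_mult; [apply smooth_const | exact H].
Qed.

Lemma smooth_curve_rot c p v :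
  smooth_curve p -> smooth_curve v -> smooth_curve (fun s => rot c (p s) (v s)).
Proof.
  intros (Hp1 & Hp2 & Hp3) (Hv1 & Hv2 & Hv3).
  destruct c; simpl; split; [ | split | | split];
    cbn [fst snd x1 x2 x3].
  - apply smooth_opp; apply smooth_plus; [ | apply smooth_opp]; apply smooth_mult; assumption.
  - apply smooth_plus; [ | apply smooth_opp]; apply smooth_mult; assumption.
  - apply smooth_plus; [ | apply smooth_opp]; apply smooth_mult; assumption.
  - apply smooth_const.
  - apply smooth_opp; assumption.
  - assumption.
Qed.

(** * The Frenet frame as an adapted moving frame *)

Lemma tangent_velocity c z :
  smooth_curve z -> (forall s, in_M c (z s)) -> forall s, tangent c (z s) (velocity z s).
Proof.
  intros Hz HM s. pose proof (smooth_curve_is_velocity _ Hz s) as Hv.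
  destruct c; simpl in *.
  - pose proof (is_derive_inner hyperbolic _ _ _ _ _ Hv Hv) as H.
    assert (H' : is_derive (fun r => inner hyperbolic (z r) (z r)) s 0).
    { apply is_derive_ext with (fun _ => - 1).
      - intros r; symmetry; apply HM.
      - apply (is_derive_const (V := R_NormedModule)). }
    apply is_derive_unique in H. apply is_derive_unique in H'.
    rewrite H, (inner_sym _ (velocity z s)) in H'. lra.
  - destruct Hv as (H1 & _ & _). apply is_derive_unique in H1. rewrite <- H1.
    apply is_derive_unique. apply is_derive_ext with (fun _ => 0).
    + intros r; symmetry; apply HM.
    + apply (is_derive_const (V := R_NormedModule)).
Qed.

(** Tangent vectors of the hyperboloid are spacelike: [p] being timelike, this is
    the reversed Cauchy-Schwarz inequality. *)
Lemma tangent_inner_pos c p v :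
  in_M c p -> tangent c p v -> v <> zero -> 0 < inner c v v.
Proof.
  intros Hp Ht Hv. apply Rnot_le_lt; intros Hle. apply Hv.
  assert (x1 v = 0 /\ x2 v = 0 /\ x3 v = 0) as (E1 & E2 & E3);
    [ | apply R3_eq; assumption].
  destruct c; simpl in *; unfold inner in *; cbn [curvature] in *.
  - destruct Hp as [Hp _].
    assert (H : x1 p * x1 v = x2 p * x2 v + x3 p * x3 v) by lra.
    pose proof (Rle_0_sqr (x2 p * x3 v - x3 p * x2 v)) as S; unfold Rsqr in S.
    assert (C : (x1 p * x1 v) * (x1 p * x1 v)
        <= (x2 p * x2 p + x3 p * x3 p) * (x2 v * x2 v + x3 v * x3 v))
      by (rewrite H; nra).
    replace (x2 p * x2 p + x3 p * x3 p) with (x1 p * x1 p - 1) in C by lra.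
    pose proof (Rle_0_sqr (x2 v)) as S2; pose proof (Rle_0_sqr (x3 v)) as S3.
    pose proof (Rle_0_sqr (x1 v)) as S1. pose proof (Rle_0_sqr (x1 p)) as Sp.
    unfold Rsqr in *.
    assert (1 <= x1 p * x1 p).
    { pose proof (Rle_0_sqr (x2 p)); pose proof (Rle_0_sqr (x3 p)); unfold Rsqr in *; lra. }
    assert (x2 v * x2 v + x3 v * x3 v <= 0) by nra.
    assert (E2 : x2 v = 0) by nra. assert (E3 : x3 v = 0) by nra.
    rewrite E2, E3 in H. repeat split; [nra | exact E2 | exact E3].
  - repeat split; [exact Ht | nra | nra].
Qed.

(** Expansion in the orthogonal basis [(p, v, rot c p v)]. In the hyperbolic case
    it follows from the double product rule for [wedge], applied to
    [e ^ (x ^ e)] with [e] the normal. *)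
Lemma tangent_decompose c p v x :
  unit_tangent c p v ->
  (match c with hyperbolic => True | euclidean => x1 x = 0 end) ->
  inner c x v = 0 ->
  x = lin2 (inner c x (rot c p v)) (rot c p v) (curvature c * inner c x p) p.
Proof.
  intros (Hp & Ht & Hu) Hx Hxv. destruct c; simpl in *.
  - pose proof (unit_tangent_rot hyperbolic p v (conj Hp (conj Ht Hu)))
      as (_ & _ & Ee); simpl in Ee.
    destruct Hp as [Hp _]. set (e := wedge p v).
    (* Double product rule: a ^ (b ^ c) = <a, b> c - <a, c> b. *)
    assert (E1 : wedge e (wedge x e)
       = lin2 (- inner hyperbolic e e) x (inner hyperbolic e x) e)
      by (unfold e; apply R3_eq; coords; ring).
    assert (E2 : wedge x e = lin2 (inner hyperbolic x p) v (- inner hyperbolic x v) p)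
      by (unfold e; apply R3_eq; coords; ring).
    assert (E3 : wedge e v = lin2 (inner hyperbolic v v) p (- inner hyperbolic p v) v)
      by (unfold e; apply R3_eq; coords; ring).
    assert (E4 : wedge e (lin2 (inner hyperbolic x p) v 0 p)
      = lin2 (inner hyperbolic x p) (wedge e v) 0 p)
      by (apply R3_eq; coords; ring).
    fold e in Ee.
    rewrite E2, Hxv, Ropp_0, E4, E3, Hu, Ht, Ee in E1.
    apply R3_eq; 
    [apply (f_equal x1) in E1 | apply (f_equal x2) in E1 | apply (f_equal x3) in E1];
    revert E1; rewrite ?x1_lin2, ?x2_lin2, ?x3_lin2, ?x1_lin2, ?x2_lin2, ?x3_lin2,
      (inner_sym _ e x); intros; lra.
  - unfold inner in *; cbn [curvature] in *.
    destruct x as [[a1 a2] a3], v as [[v1 v2] v3]; unfold x1, x2, x3 in *; simpl in *.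
    subst a1 v1.
    apply R3_eq; rewrite ?x1_lin2, ?x2_lin2, ?x3_lin2; unfold x1, x2, x3; simpl.
    + ring.
    + apply Rminus_diag_uniq.
      transitivity (a2 * (1 - (0 * 0 * 0 + v2 * v2 + v3 * v3))
                    + v2 * (0 * 0 * 0 + a2 * v2 + a3 * v3)); [ring | ].
      rewrite Hu, Hxv; ring.
    + apply Rminus_diag_uniq.
      transitivity (a3 * (1 - (0 * 0 * 0 + v2 * v2 + v3 * v3))
                    + v3 * (0 * 0 * 0 + a2 * v2 + a3 * v3)); [ring | ].
      rewrite Hu, Hxv; ring.
Qed.

Definition speed c (z : R -> R3) (s : R) : R :=
  sqrt (inner c (velocity z s) (velocity z s)).

(** The turning rate of the Frenet frame per unit of the given parameter, equal to
    the geodesic curvature for a curve parametrized by arc length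
    ([geodesic_curvature_eq]). *)
Definition frenet_turning c z s :=
  inner c (velocity (frenet_t c z) s) (frenet_e c z s).

Lemma is_derive_inner_const c u v s u' v' k :
  (forall r, inner c (u r) (v r) = k) ->
  is_velocity u s u' -> is_velocity v s v' ->
  inner c u' (v s) + inner c (u s) v' = 0.
Proof.
  intros H Hu Hv. pose proof (is_derive_inner c _ _ _ _ _ Hu Hv) as H1.
  apply is_derive_unique in H1. rewrite <- H1.
  apply is_derive_unique, is_derive_ext with (fun _ => k).
  - intros r; symmetry; apply H.
  - apply (is_derive_const (V := R_NormedModule)).
Qed.

Lemma is_velocity_rot c p t s p' t' :
  is_velocity p s p' -> is_velocity t s t' ->
  is_velocity (fun r => rot c (p r) (t r)) s
    (plus (match c with hyperbolic => wedge p' (t s) | euclidean => zero end)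
       (rot c (p s) t')).
Proof.
  intros Hp Ht. destruct c.
  - exact (is_velocity_wedge _ _ _ _ _ Hp Ht).
  - destruct Ht as (H1 & H2 & H3). split; [ | split].
    + refine (is_derive_eq (fun _ => 0) s 0 _ _
        (is_derive_const (V := R_NormedModule) 0 s)).
      change (0 = 0 + 0). ring.
    + refine (is_derive_eq (fun r => - x3 (t r)) s (- x3 t') _ _
        (is_derive_opp (V := R_NormedModule) _ _ _ H3)).
      change (- x3 t' = 0 + - x3 t'). ring.
    + refine (is_derive_eq (fun r => x2 (t r)) s (x2 t') _ _ H2).
      change (x2 t' = 0 + x2 t'). ring.
Qed.

(** Differentiating the orthonormality relations leaves the normal component of
    [t'] as the only unknown. *)
Lemma moving_frame_rot c p t s a t' :
  (forall r, unit_tangent c (p r) (t r)) ->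
  is_velocity p s (scal a (t s)) -> is_velocity t s t' ->
  moving_frame c p t (fun r => rot c (p r) (t r)) s a 0
    (inner c t' (rot c (p s) (t s))).
Proof.
  intros Hu Hp Ht. set (e := rot c (p s) (t s)). set (w := inner c t' e).
  assert (Etp : inner c t' (p s) * curvature c = - curvature c * a).
  { destruct c; [ | simpl; ring].
    pose proof (is_derive_inner_const hyperbolic p t s _ _ 0
      (fun r => proj1 (proj2 (Hu r))) Hp Ht) as H.
    destruct (Hu s) as (_ & _ & H1).
    change (scal a (t s)) with (scal a (t s) : R3) in H.
    assert (H2 : inner hyperbolic (scal a (t s)) (t s) = a * inner hyperbolic (t s) (t s)).
    { unfold inner.
      change (x1 (scal a (t s))) with (a * x1 (t s)).
      change (x2 (scal a (t s))) with (a * x2 (t s)).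
      change (x3 (scal a (t s))) with (a * x3 (t s)). ring. }
    rewrite H2, H1, (inner_sym _ (p s)) in H. simpl. lra. }
  assert (Et : t' = lin2 w e (- curvature c * a) (p s)).
  { transitivity (lin2 w e (curvature c * inner c t' (p s)) (p s)).
    - apply tangent_decompose; [apply Hu | | ].
      + destruct c; [exact I | ]. destruct Ht as (H1 & _).
        apply is_derive_unique in H1. rewrite <- H1.
        apply is_derive_unique, is_derive_ext with (fun _ => 0).
        * intros r; symmetry; apply (Hu r).
        * apply (is_derive_const (V := R_NormedModule)).
      + pose proof (is_derive_inner_const c t t s _ _ 1
          (fun r => proj2 (proj2 (Hu r))) Ht Ht) as H.
        rewrite (inner_sym c (t s)) in H. lra.
    - f_equal. rewrite <- Etp. ring. }
  split; [ | split].
  - eapply is_velocity_ext; [ | exact Hp]. vec_eq; ring.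
  - eapply is_velocity_ext; [exact Et | exact Ht].
  - eapply is_velocity_ext; [ | exact (is_velocity_rot c _ _ _ _ _ Hp Ht)].
    rewrite Et, rot_lin2. unfold e at 1. rewrite (rot_rot _ _ _ (Hu s)).
    fold e. destruct c; cbn [rot curvature].
    + apply R3_eq;
      match goal with |- ?f (plus ?x ?y) = _ => change (f (plus x y)) with (f x + f y) end;
      rewrite ?x1_wedge, ?x2_wedge, ?x3_wedge;
      change (x1 (scal a (t s))) with (a * x1 (t s));
      change (x2 (scal a (t s))) with (a * x2 (t s));
      change (x3 (scal a (t s))) with (a * x3 (t s)); coords; ring.
    + apply R3_eq;
      match goal with |- ?f (plus ?x ?y) = _ => change (f (plus x y)) with (0 + f y) end;
      coords; unfold x1, x2, x3; simpl; ring.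
Qed.

Lemma regular_speed_pos c z : regular_curve c z -> forall s, 0 < speed c z s.
Proof.
  intros (Hz & HM & Hv) s. apply sqrt_lt_R0, tangent_inner_pos with (z s); auto.
  apply tangent_velocity; assumption.
Qed.

Lemma scal_lin2 a (v : R3) : scal a v = lin2 a v 0 v.
Proof.
  apply R3_eq; rewrite ?x1_lin2, ?x2_lin2, ?x3_lin2;
  match goal with |- ?f (scal ?x ?y) = _ => change (f (scal x y)) with (x * f y) end; ring.
Qed.

Lemma frenet_t_unit c z :
  regular_curve c z -> forall s, unit_tangent c (z s) (frenet_t c z s).
Proof.
  intros H s. pose proof (regular_speed_pos _ _ H s) as Hs.
  destruct H as (Hz & HM & Hv). unfold frenet_t. fold (speed c z s).
  assert (Hsq : inner c (velocity z s) (velocity z s) = speed c z s * speed c z s).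
  { symmetry; apply sqrt_sqrt, Rlt_le, tangent_inner_pos with (z s); auto.
    apply tangent_velocity; assumption. }
  rewrite scal_lin2. split; [apply HM | split].
  - apply tangent_lin2; apply tangent_velocity; assumption.
  - rewrite inner_lin2_l, !inner_lin2_r, Hsq. field. lra.
Qed.

Lemma frenet_moving_frame c z :
  regular_curve c z ->
  forall s, moving_frame c z (frenet_t c z) (frenet_e c z) s
    (speed c z s) 0 (frenet_turning c z s).
Proof.
  intros H s. pose proof (regular_speed_pos _ _ H) as Hs.
  pose proof (frenet_t_unit _ _ H) as Hu. destruct H as (Hz & HM & Hv).
  pose proof (smooth_curve_is_velocity _ Hz s) as Hp.
  pose proof (smooth_curve_is_velocity _ (smooth_curve_velocity _ Hz) s) as Hpp.
  apply moving_frame_rot with (t' := velocity (frenet_t c z) s).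
  - exact Hu.
  - eapply is_velocity_ext; [ | exact Hp]. unfold frenet_t; fold (speed c z s).
    rewrite !scal_lin2. specialize (Hs s). apply R3_eq; coords; field; lra.
  - assert (exists t', is_velocity (frenet_t c z) s t') as [t' Ht'];
      [ | rewrite (is_velocity_unique _ _ _ Ht'); exact Ht'].
    pose proof (is_derive_inner c _ _ _ _ _ Hpp Hpp) as H1.
    specialize (Hs s).
    assert (H2 : 0 < inner c (velocity z s) (velocity z s))
      by (apply tangent_inner_pos with (z s); auto; apply tangent_velocity; assumption).
    assert (H3 : ex_derive (fun r => / speed c z r) s).
    { apply ex_derive_inv; [ | lra].
      eexists. refine (is_derive_Rcomp sqrt _ s _ _ _ H1).
      apply is_derive_Reals, derivable_pt_lim_sqrt, H2. }
    destruct H3 as [d Hd].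
    eexists. replace (frenet_t c z)
      with (fun r => lin2 (/ speed c z r) (velocity z r) 0 (velocity z r)).
    + exact (is_velocity_lin2 _ _ _ _ _ _ _ _ _ Hd Hpp
        (is_derive_const (V := R_NormedModule) 0 s) Hpp).
    + apply functional_extensionality; intros r. unfold frenet_t; fold (speed c z r).
      rewrite (scal_lin2 (/ speed c z r)). apply R3_eq; coords; ring.
Qed.

Lemma velocity_periodic z L :
  (forall s, z (s + L) = z s) -> forall s, velocity z (s + L) = velocity z s.
Proof.
  intros H s.
  assert (K : forall g : R3 -> R,
    Derive (fun u => g (z u)) (s + L) = Derive (fun u => g (z u)) s).
  { intros g. unfold Derive. f_equal. apply Lim_ext. intros e.
    replace (s + L + e) with (s + e + L) by ring. rewrite !H. reflexivity. }
  unfold velocity. rewrite (K x1), (K x2), (K x3). reflexivity.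
Qed.

Lemma frenet_t_eq c z s v t x :
  velocity z s = lin2 v t 0 x -> inner c t t = 1 -> 0 < v -> frenet_t c z s = t.
Proof.
  intros H Ht Hv. unfold frenet_t. rewrite H.
  assert (E : inner c (lin2 v t 0 x) (lin2 v t 0 x) = v * v)
    by (rewrite inner_lin2_l, !inner_lin2_r, Ht; ring).
  rewrite E, sqrt_square by lra. rewrite scal_lin2.
  apply R3_eq; coords; field; lra.
Qed.

Lemma arc_length_regular c z :
  smooth_curve z -> (forall s, in_M c (z s)) -> arc_length c z -> regular_curve c z.
Proof.
  intros Hz HM Ha. split; [exact Hz | split; [exact HM | ]].
  intros s Hs. specialize (Ha s). rewrite Hs in Ha.
  unfold inner, x1, x2, x3 in Ha. simpl in Ha. unfold zero in Ha; simpl in Ha. lra.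
Qed.

Lemma arc_length_frenet_t c z : arc_length c z -> frenet_t c z = velocity z.
Proof.
  intros H. apply functional_extensionality; intros s. unfold frenet_t.
  rewrite (H s), sqrt_1, Rinv_1. apply (scal_one (velocity z s)).
Qed.

Lemma arc_length_moving_frame c z :
  regular_curve c z -> arc_length c z ->
  forall s, moving_frame c z (frenet_t c z) (frenet_e c z) s 1 0 (frenet_turning c z s).
Proof.
  intros Hr Ha s. pose proof (frenet_moving_frame c z Hr s) as H.
  unfold speed in H. rewrite (Ha s), sqrt_1 in H. exact H.
Qed.

Lemma plus_scal_lin2 (u : R3) b (v : R3) : plus u (scal b v) = lin2 1 u b v.
Proof.
  apply R3_eq; rewrite ?x1_lin2, ?x2_lin2, ?x3_lin2, Rmult_1_l; reflexivity.
Qed.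

Lemma geodesic_curvature_eq c z k :
  regular_curve c z -> arc_length c z -> geodesic_curvature c z k ->
  forall s, k s = frenet_turning c z s.
Proof.
  intros Hr Ha Hk s. specialize (Hk s).
  destruct (arc_length_moving_frame c z Hr Ha s) as (_ & Ht & _).
  pose proof (frenet_t_unit c z Hr s) as Hu.
  apply is_velocity_unique in Ht.
  unfold covariant_acc in Hk. rewrite (arc_length_frenet_t c z Ha) in Ht at 1.
  rewrite Ht in Hk.
  destruct (unit_tangent_rot c _ _ Hu) as (HM & Het & He).
  fold (frenet_e c z s) in Het, He.
  destruct c; rewrite ?plus_scal_lin2, scal_lin2 in Hk; cbn [tangent] in Het.
  - apply (f_equal (fun x => inner hyperbolic x (frenet_e hyperbolic z s))) in Hk.
    rewrite !inner_lin2_l, He, Het in Hk. simpl in Hk. lra.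
  - apply (f_equal (fun x => inner euclidean x (frenet_e euclidean z s))) in Hk.
    rewrite !inner_lin2_l, He in Hk. simpl in Hk. lra.
Qed.

(** * Monotonicity and periodicity on the line *)

Lemma derive_nonneg_le (f f' : R -> R) x y :
  (forall z, is_derive f z (f' z)) -> (forall z, 0 <= f' z) -> x <= y -> f x <= f y.
Proof.
  intros H H' Hxy. destruct (mean_value f f' x y H) as [z [_ Hz]].
  specialize (H' z). nra.
Qed.

Lemma derive_pos_reflects_le (f f' : R -> R) x y :
  (forall z, is_derive f z (f' z)) -> (forall z, 0 < f' z) -> f x <= f y -> x <= y.
Proof.
  intros H H' Hxy. destruct (mean_value f f' x y H) as [z [_ Hz]].
  specialize (H' z). nra.
Qed.

Lemma derive_0_const (f : R -> R) x y :
  (forall z, is_derive f z 0) -> f x = f y.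
Proof.
  intros H.
  assert (W : forall a b, a <= b -> f a = f b).
  { intros a b Hab. apply Rle_antisym.
    - apply (derive_nonneg_le f (fun _ => 0)); auto; intros; lra.
    - cut (- f a <= - f b); [lra | ].
      apply (derive_nonneg_le (fun u => - f u) (fun _ => - 0)); auto; [ | intros; lra].
      intros z. exact (is_derive_opp f z 0 (H z)). }
  destruct (Rle_dec x y); [ | symmetry]; apply W; lra.
Qed.

Lemma periodic_IZR (g : R -> R) L :
  (forall s, g (s + L) = g s) -> forall n s, g (s + IZR n * L) = g s.
Proof.
  intros H.
  assert (N : forall n s, g (s + INR n * L) = g s).
  { induction n as [ | n IH]; intros s; [simpl; f_equal; ring | ].
    rewrite S_INR. replace (s + (INR n + 1) * L) with (s + INR n * L + L) by ring.
    rewrite H; apply IH. }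
  intros n s. destruct (Z_le_dec 0 n) as [Hn | Hn].
  - rewrite <- (Z2Nat.id n Hn), <- INR_IZR_INZ. apply N.
  - rewrite <- (N (Z.to_nat (- n)) (s + IZR n * L)). f_equal.
    rewrite INR_IZR_INZ, Z2Nat.id, opp_IZR by lia. ring.
Qed.

(** Reduction modulo the period carries global extrema of a continuous periodic
    function back to a compact interval. *)
Lemma periodic_reduce (g : R -> R) L :
  0 < L -> (forall s, g (s + L) = g s) ->
  forall s, exists x, 0 <= x <= L /\ g s = g x.
Proof.
  intros HL H s. destruct (archimed (s / L)) as [A1 A2].
  set (n := up (s / L)) in *.
  exists (s + IZR (1 - n) * L). split; [ | symmetry; apply periodic_IZR, H].
  rewrite minus_IZR.
  assert (s = s / L * L) by (field; lra). set (y := s / L) in *. nra.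
Qed.

Lemma periodic_bounded (g : R -> R) L :
  0 < L -> (forall s, g (s + L) = g s) -> (forall s, continuous g s) ->
  (exists x, forall s, g s <= g x) /\ (exists x, forall s, g x <= g s).
Proof.
  intros HL H Hc.
  assert (Hc' : forall c, 0 <= c <= L -> continuity_pt g c)
    by (intros c _; apply continuity_pt_filterlim, Hc).
  split.
  - destruct (continuity_ab_maj g 0 L (Rlt_le _ _ HL) Hc') as [x [Hx _]].
    exists x; intros s. destruct (periodic_reduce g L HL H s) as [y [Hy ->]]; auto.
  - destruct (continuity_ab_min g 0 L (Rlt_le _ _ HL) Hc') as [x [Hx _]].
    exists x; intros s. destruct (periodic_reduce g L HL H s) as [y [Hy ->]]; auto.
Qed.

(** * Exponential averages over a period *)

Definition prim (h : R -> R) (x : R) : R := RInt h 0 x.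

Lemma is_derive_prim h :
  (forall x, continuous h x) -> forall x, is_derive (prim h) x (h x).
Proof.
  intros H x. apply (is_derive_RInt h (prim h) 0 x); [ | apply H].
  apply filter_forall; intros y.
  apply (RInt_correct h), (ex_RInt_continuous h). intros; apply H.
Qed.

Definition exp_weight (l : R) (g : R -> R) (u : R) : R := exp (l * u) * g u.

(** The average of [g] on [[s, s + L]] for the weight [exp (l u)], normalized to
    have mass 1. For [g] of period [L] it is the unique periodic solution of
    [y' = l (g - y)]; writing it with a primitive lets all its properties follow
    from monotonicity of functions rather than of integrals. *)
Definition exp_average (l L : R) (g : R -> R) (s : R) : R :=
  l / (exp (l * L) - 1) * exp (- l * s)
  * (prim (exp_weight l g) (s + L) - prim (exp_weight l g) s).

Lemma is_derive_exp_lin l x : is_derive (fun u => exp (l * u)) x (l * exp (l * x)).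
Proof. auto_derive; [exact I | ring]. Qed.

Lemma is_derive_prim_weight l g :
  (forall x, continuous g x) ->
  forall x, is_derive (prim (exp_weight l g)) x (exp (l * x) * g x).
Proof.
  intros H x. apply (is_derive_prim (exp_weight l g)).
  intros y. apply (continuous_mult (fun u => exp (l * u)) g); [ | apply H].
  apply (ex_derive_continuous (fun u => exp (l * u))).
  eexists; apply is_derive_exp_lin.
Qed.

Lemma is_derive_shift (f : R -> R) L x l :
  is_derive f (x + L) l -> is_derive (fun u => f (u + L)) x l.
Proof.
  intros H. replace l with (l * (1 + 0)) by ring.
  apply (is_derive_Rcomp f (fun u => u + L)); [exact H | ].
  apply (is_derive_plus (fun u => u) (fun _ => L)).
  - apply (is_derive_id x).
  - apply (is_derive_const L x).
Qed.

Lemma exp_gt_1 x : 0 < x -> 1 < exp x.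
Proof. intros H. rewrite <- exp_0. apply exp_increasing, H. Qed.

(** The difference of the two sides, times the weight, is the increment of a
    primitive of [exp (l u) (g2 + d - g1)], which is nondecreasing. *)
Lemma exp_average_le l L g1 g2 d s :
  0 < l -> 0 < L ->
  (forall x, continuous g1 x) -> (forall x, continuous g2 x) ->
  (forall x, g1 x <= g2 x + d) ->
  exp_average l L g1 s <= exp_average l L g2 s + d.
Proof.
  intros Hl HL H1 H2 Hd.
  set (G1 := prim (exp_weight l g1)). set (G2 := prim (exp_weight l g2)).
  assert (D : G2 s + d / l * exp (l * s) - G1 s
    <= G2 (s + L) + d / l * exp (l * (s + L)) - G1 (s + L)).
  { apply (derive_nonneg_le (fun u => G2 u + d / l * exp (l * u) - G1 u)
      (fun u => exp (l * u) * g2 u + d / l * (l * exp (l * u)) - exp (l * u) * g1 u)).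
    - intros z. apply (is_derive_minus (fun u => G2 u + d / l * exp (l * u)) G1);
        [apply (is_derive_plus G2) | ]; try (apply is_derive_prim_weight; assumption).
      apply is_derive_scal, is_derive_exp_lin.
    - intros z. replace (d / l * (l * exp (l * z))) with (d * exp (l * z)) by (field; lra).
      specialize (Hd z). pose proof (exp_pos (l * z)). nra.
    - lra. }
  unfold exp_average. fold G1 G2.
  assert (HlL : 0 < l * L) by nra. pose proof (exp_gt_1 _ HlL).
  assert (Hx : exp (l * (s + L)) = exp (l * s) * exp (l * L))
    by (rewrite <- exp_plus; f_equal; ring).
  assert (Hm : exp (- l * s) * exp (l * s) = 1)
    by (rewrite <- exp_plus, <- exp_0; f_equal; ring).
  set (C := l / (exp (l * L) - 1) * exp (- l * s)).
  assert (HC : 0 < C)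
    by (apply Rmult_lt_0_compat; [apply Rdiv_lt_0_compat; lra | apply exp_pos]).
  assert (Cd : C * (d / l * exp (l * (s + L)) - d / l * exp (l * s)) = d).
  { unfold C. rewrite Hx. transitivity (d * (exp (- l * s) * exp (l * s)));
      [field; lra | rewrite Hm; ring]. }
  match goal with |- ?a <= ?b + d => change (a <= b + d) end.
  nra.
Qed.

Lemma exp_average_const l L d s :
  0 < l -> 0 < L -> exp_average l L (fun _ => d) s = d.
Proof.
  intros Hl HL.
  assert (Z : exp_average l L (fun _ => 0) s = 0).
  { unfold exp_average. rewrite (derive_0_const (prim (exp_weight l (fun _ => 0))) (s + L) s).
    - ring.
    - intros z. refine (is_derive_eq _ _ _ _ _
        (is_derive_prim_weight l (fun _ => 0) (fun x => continuous_const 0 x) z)). ring. }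
  assert (K : forall a x : R, continuous (fun _ : R => a) x)
    by (intros; apply continuous_const).
  assert (U : exp_average l L (fun _ => d) s <= exp_average l L (fun _ => 0) s + d)
    by (apply exp_average_le; auto; intros; lra).
  assert (V : exp_average l L (fun _ => 0) s <= exp_average l L (fun _ => d) s + - d)
    by (apply exp_average_le; auto; intros; lra).
  lra.
Qed.

(** With [G] the weighted primitive, [G (u + L) - exp (l L) G u] has zero
    derivative, hence the same value at [s] and at [s + L]. *)
Lemma exp_average_periodic l L g :
  (forall x, continuous g x) -> (forall x, g (x + L) = g x) ->
  forall s, exp_average l L g (s + L) = exp_average l L g s.
Proof.
  intros Hc Hg s. unfold exp_average. set (G := prim (exp_weight l g)).
  pose proof (is_derive_prim_weight l g Hc) as HG. fold G in HG.
  assert (D : G (s + L + L) - exp (l * L) * G (s + L) = G (s + L) - exp (l * L) * G s).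
  { apply (derive_0_const (fun u => G (u + L) - exp (l * L) * G u) (s + L) s).
    intros z.
    replace 0 with (exp (l * (z + L)) * g (z + L) - exp (l * L) * (exp (l * z) * g z)).
    - apply (is_derive_minus (fun u => G (u + L)) (fun u => exp (l * L) * G u)).
      + apply is_derive_shift, HG.
      + apply is_derive_scal, HG.
    - rewrite Hg, Rmult_plus_distr_l, exp_plus. ring. }
  replace (G (s + L + L)) with (exp (l * L) * (G (s + L) - G s) + G (s + L)) by lra.
  replace (exp (- l * s)) with (exp (- l * (s + L)) * exp (l * L))
    by (rewrite <- exp_plus; f_equal; ring).
  ring.
Qed.

Lemma is_derive_exp_average l L g :
  0 < l -> 0 < L ->
  (forall x, continuous g x) -> (forall x, g (x + L) = g x) ->
  forall s, is_derive (exp_average l L g) s (l * (g s - exp_average l L g s)).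
Proof.
  intros Hl HL Hc Hg s. unfold exp_average. set (G := prim (exp_weight l g)).
  pose proof (is_derive_prim_weight l g Hc) as HG. fold G in HG.
  assert (HlL : 0 < l * L) by nra. pose proof (exp_gt_1 _ HlL).
  assert (Hm : exp (- l * s) * exp (l * s) = 1)
    by (rewrite <- exp_plus, <- exp_0; f_equal; ring).
  set (C := l / (exp (l * L) - 1)).
  refine (is_derive_eq _ _ _ _ _ (is_derive_Rmult
    (fun u => C * exp (- l * u)) (fun u => G (u + L) - G u) s _ _
    (is_derive_scal _ _ C _ (is_derive_exp_lin (- l) s))
    (is_derive_minus (fun u => G (u + L)) G s _ _
      (is_derive_shift G L s _ (HG (s + L))) (HG s)))).
  change minus with Rminus || idtac.
  change (C * (- l * exp (- l * s)) * (G (s + L) - G s)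
    + C * exp (- l * s) * (exp (l * (s + L)) * g (s + L) - exp (l * s) * g s)
    = l * (g s - C * exp (- l * s) * (G (s + L) - G s))).
  rewrite Hg, Rmult_plus_distr_l, exp_plus.
  transitivity (- l * (C * exp (- l * s) * (G (s + L) - G s))
    + C * (exp (l * L) - 1) * (exp (- l * s) * exp (l * s)) * g s); [ring | ].
  rewrite Hm. unfold C. field. lra.
Qed.

(** * The periodic solution of the radial equation *)

(** [f' = 1 - q sin_c(f)] is equivalent to [f' = l (euler_step f - f)], so its
    periodic solutions are the fixed points of [f |-> exp_average (euler_step f)].
    The name comes from the explicit Euler scheme with step [1 / l]. *)
Definition euler_step c (q : R -> R) (l : R) (f : R -> R) (s : R) : R :=
  f s + (1 - q s * sin_c c (f s)) / l.

Definition admissible L m (f : R -> R) : Prop :=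
  (forall s, 0 <= f s <= m) /\ (forall s, continuous f s) /\
  (forall s, f (s + L) = f s).

Lemma exp_average_contract l L g1 g2 d s :
  0 < l -> 0 < L ->
  (forall x, continuous g1 x) -> (forall x, continuous g2 x) ->
  (forall x, Rabs (g1 x - g2 x) <= d) ->
  Rabs (exp_average l L g1 s - exp_average l L g2 s) <= d.
Proof.
  intros Hl HL H1 H2 Hd. apply Rabs_le.
  assert (exp_average l L g1 s <= exp_average l L g2 s + d).
  { apply exp_average_le; auto. intros x; specialize (Hd x).
    apply Rabs_le_between in Hd. lra. }
  assert (exp_average l L g2 s <= exp_average l L g1 s + d).
  { apply exp_average_le; auto. intros x; specialize (Hd x).
    apply Rabs_le_between in Hd. lra. }
  lra.
Qed.

Lemma exp_average_bounds l L g a b s :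
  0 < l -> 0 < L -> (forall x, continuous g x) ->
  (forall x, a <= g x <= b) -> a <= exp_average l L g s <= b.
Proof.
  intros Hl HL Hc Hg.
  assert (K : forall a x : R, continuous (fun _ : R => a) x)
    by (intros; apply continuous_const).
  assert (U : exp_average l L g s <= exp_average l L (fun _ => b) s + 0)
    by (apply exp_average_le; auto; intros x; specialize (Hg x); lra).
  assert (V : exp_average l L (fun _ => a) s <= exp_average l L g s + 0)
    by (apply exp_average_le; auto; intros x; specialize (Hg x); lra).
  rewrite exp_average_const in U, V by assumption. lra.
Qed.

(** The slope in [x] is [1 - q cos_c(x) / l], which lies between [0] and
    [1 - q0 / l] on [[0, m]] once [l] dominates [q1 cos_c(m)]. *)
Lemma euler_step_contract c (q : R -> R) l q0 q1 m x y s :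
  0 < q0 -> (forall s, q0 <= q s <= q1) -> l = q1 * cos_c c m ->
  0 <= x -> x <= y -> y <= m ->
  0 <= (y + (1 - q s * sin_c c y) / l) - (x + (1 - q s * sin_c c x) / l)
    <= (1 - q0 / l) * (y - x).
Proof.
  intros Hq0 Hq Hl Hx Hxy Hy. specialize (Hq s).
  pose proof (cos_c_ge_1 c m) as Hcm.
  assert (l0 : 0 < l) by (rewrite Hl; nra).
  pose proof (sin_c_expand c x y Hxy) as E1.
  pose proof (sin_c_lipschitz c m x y Hx Hxy Hy) as E2.
  set (X := sin_c c x) in *; set (Y := sin_c c y) in *.
  replace (y + (1 - q s * Y) / l - (x + (1 - q s * X) / l))
    with ((y - x) - (q s * (Y - X)) / l) by (field; lra).
  assert (U : q0 * (y - x) <= q s * (Y - X)) by nra.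
  assert (V : q s * (Y - X) <= l * (y - x)).
  { rewrite Hl. apply Rle_trans with (q1 * (Y - X)); nra. }
  split.
  - apply (Rmult_le_reg_l l); [exact l0 | ].
    replace (l * (y - x - q s * (Y - X) / l)) with (l * (y - x) - q s * (Y - X))
      by (field; lra). lra.
  - apply (Rmult_le_reg_l l); [exact l0 | ].
    replace (l * (y - x - q s * (Y - X) / l)) with (l * (y - x) - q s * (Y - X))
      by (field; lra).
    replace (l * ((1 - q0 / l) * (y - x))) with (l * (y - x) - q0 * (y - x))
      by (field; lra). lra.
Qed.

Lemma continuous_euler_step c q l f :
  (forall s, continuous q s) -> (forall s, continuous f s) ->
  forall s, continuous (euler_step c q l f) s.
Proof.
  intros Hq Hf s. unfold euler_step.
  apply (continuous_plus f (fun s => (1 - q s * sin_c c (f s)) / l)); [apply Hf | ].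
  apply (continuous_mult (fun s => 1 - q s * sin_c c (f s)) (fun _ => / l));
    [ | apply continuous_const].
  apply (continuous_minus (fun _ => 1) (fun s => q s * sin_c c (f s)));
    [apply continuous_const | ].
  apply (continuous_mult q (fun s => sin_c c (f s))); [apply Hq | ].
  apply (continuous_comp f (sin_c c)); [apply Hf | ].
  apply (ex_derive_continuous (sin_c c)). eexists; apply is_derive_sin_c.
Qed.

(** Picard iteration from [0] in the functions with values in [[0, m]]. The bound
    [m = 1 / q0] is a supersolution because [q sin_c(m) >= q0 m = 1], and positivity
    comes for free: every value of the average is at least [1 / l], the step
    from [0]. *)
Lemma exists_periodic_solution c (q : R -> R) L q0 q1 :
  0 < L -> 0 < q0 -> (forall s, q0 <= q s <= q1) ->
  (forall s, continuous q s) -> (forall s, q (s + L) = q s) ->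
  exists f : R -> R,
    (forall s, is_derive f s (1 - q s * sin_c c (f s))) /\
    (forall s, f (s + L) = f s) /\ (forall s, 0 < f s).
Proof.
  intros HL Hq0 Hq Hqc Hqp.
  set (m := / q0). set (l := q1 * cos_c c m).
  assert (Hm : 0 < m) by (apply Rinv_0_lt_compat, Hq0).
  assert (Hl : q0 <= l).
  { unfold l. pose proof (cos_c_ge_1 c m). specialize (Hq 0). nra. }
  assert (l0 : 0 < l) by lra.
  set (rho := 1 - q0 / l).
  assert (Hrho : 0 <= rho < 1).
  { unfold rho. assert (0 < q0 / l) by (apply Rdiv_lt_0_compat; lra).
    assert (q0 / l <= 1) by (apply (Rmult_le_reg_r l); [lra | ];
      unfold Rdiv; rewrite Rmult_assoc, Rinv_l; lra). lra. }
  assert (Hm1 : forall s, 1 - q s * sin_c c m <= 0).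
  { intros s. specialize (Hq s). pose proof (sin_c_expand c 0 m (Rlt_le _ _ Hm)) as E.
    rewrite sin_c_0 in E. assert (q0 * m = 1) by (apply Rinv_r; lra). nra. }
  assert (Hstep : forall f, admissible L m f ->
    forall s, / l <= euler_step c q l f s <= m).
  { intros f (Hf & _ & _) s. unfold euler_step. specialize (Hf s).
    pose proof (euler_step_contract c q l q0 q1 m 0 (f s) s Hq0 Hq eq_refl
      (Rle_refl 0) (proj1 Hf) (proj2 Hf)) as [E1 _].
    pose proof (euler_step_contract c q l q0 q1 m (f s) m s Hq0 Hq eq_refl
      (proj1 Hf) (proj2 Hf) (Rle_refl m)) as [E2 _].
    rewrite sin_c_0 in E1. split.
    - replace (0 + (1 - q s * 0) / l) with (/ l) in E1 by (field; lra). lra.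
    - assert ((1 - q s * sin_c c m) / l <= 0); [ | lra].
      apply (Rmult_le_reg_r l); [exact l0 | ].
      unfold Rdiv. rewrite Rmult_assoc, Rinv_l by lra. specialize (Hm1 s). lra. }
  assert (Hcontr : forall f g d, admissible L m f -> admissible L m g ->
    (forall s, Rabs (f s - g s) <= d) ->
    forall s, Rabs (euler_step c q l f s - euler_step c q l g s) <= rho * d).
  { intros f g d (Hf & _ & _) (Hg & _ & _) Hd s. unfold euler_step.
    specialize (Hf s); specialize (Hg s); specialize (Hd s).
    apply Rabs_le_between in Hd. apply Rabs_le.
    destruct (Rle_dec (f s) (g s)) as [Hfg | Hfg].
    - pose proof (euler_step_contract c q l q0 q1 m (f s) (g s) s Hq0 Hq eq_refl
        (proj1 Hf) Hfg (proj2 Hg)) as E. fold rho in E. nra.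
    - assert (Hgf : g s <= f s) by lra.
      pose proof (euler_step_contract c q l q0 q1 m (g s) (f s) s Hq0 Hq eq_refl
        (proj1 Hg) Hgf (proj2 Hf)) as E. fold rho in E. nra. }
  set (T := fun f => exp_average l L (euler_step c q l f)).
  assert (Hper : forall f, admissible L m f ->
      forall s, euler_step c q l f (s + L) = euler_step c q l f s)
    by (intros f (_ & _ & Hp) s; unfold euler_step; rewrite Hqp, Hp; reflexivity).
  assert (Hcont : forall f, admissible L m f ->
      forall s, continuous (euler_step c q l f) s)
    by (intros f (_ & Hc & _); apply continuous_euler_step; assumption).
  assert (HTd : forall f, admissible L m f ->
    forall s, is_derive (T f) s (l * (euler_step c q l f s - T f s)))
    by (intros f Hf; apply is_derive_exp_average; auto).
  assert (HTb : forall f, admissible L m f -> forall s, / l <= T f s <= m)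
    by (intros f Hf s; apply exp_average_bounds; auto).
  assert (HT : forall f, admissible L m f -> admissible L m (T f)).
  { intros f Hf. split; [ | split].
    - intros s. pose proof (HTb f Hf s). pose proof (Rinv_0_lt_compat l l0). lra.
    - intros s. apply (ex_derive_continuous (T f)). eexists; apply HTd, Hf.
    - apply exp_average_periodic; auto. }
  set (F := fix F n := match n with O => fun _ : R => 0 | S n => T (F n) end).
  assert (HF : forall n, admissible L m (F n)).
  { induction n as [ | n IH]; [ | apply HT, IH].
    split; [ | split]; intros s; simpl; [lra | apply continuous_const | reflexivity]. }
  (* As [F 0 = 0] and all iterates lie in [0, m], contraction alone gives the
     Cauchy estimate, with no geometric series. *)
  assert (Hcauchy : forall n p s, Rabs (F (n + p)%nat s - F n s) <= rho ^ n * m).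
  { induction n as [ | n IH]; intros p s.
    - simpl. rewrite Rabs_pos_eq; destruct (HF p) as (Hb & _); specialize (Hb s); lra.
    - simpl. apply exp_average_contract; auto.
      intros x. rewrite Rmult_assoc. apply Hcontr; auto. }
  assert (Hpow : forall eps, 0 < eps -> exists N, forall n, (N <= n)%nat -> rho ^ n * m < eps).
  { intros eps Heps.
    pose proof (is_lim_seq_geom rho ltac:(rewrite Rabs_pos_eq; lra)) as Hg.
    apply is_lim_seq_spec in Hg.
    destruct (Hg (mkposreal (eps / m) (Rdiv_lt_0_compat _ _ Heps Hm))) as [N HN].
    exists N. intros n Hn. specialize (HN n Hn). simpl in HN.
    rewrite Rminus_0_r in HN. apply Rabs_def2 in HN.
    destruct HN as [HN _]. apply (Rmult_lt_compat_r m _ _ Hm) in HN.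
    replace (eps / m * m) with eps in HN by (field; lra). exact HN. }
  assert (Hlim : forall s, exists x, is_lim_seq (fun n => F n s) (Finite x)).
  { intros s. apply ex_lim_seq_cauchy_corr. intros eps.
    destruct (Hpow (eps / 2)) as [N HN]; [apply is_pos_div_2 | ].
    exists N. intros n p Hn Hp.
    replace (F n s - F p s) with ((F n s - F N s) - (F p s - F N s)) by ring.
    pose proof (Hcauchy N (n - N)%nat s) as C1. pose proof (Hcauchy N (p - N)%nat s) as C2.
    replace (N + (n - N))%nat with n in C1 by lia.
    replace (N + (p - N))%nat with p in C2 by lia.
    specialize (HN N (Nat.le_refl N)).
    apply Rabs_le_between in C1. apply Rabs_le_between in C2.
    apply Rabs_def1; lra. }
  set (f := fun s => real (Lim_seq (fun n => F n s))).
  assert (Hf : forall s, is_lim_seq (fun n => F n s) (Finite (f s))).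
  { intros s. destruct (Hlim s) as [x Hx]. unfold f.
    rewrite (is_lim_seq_unique _ _ Hx). exact Hx. }
  assert (Hclose : forall n s, Rabs (f s - F n s) <= rho ^ n * m).
  { intros n s. apply Rabs_le.
    assert (Hs : is_lim_seq (fun p => F (n + p)%nat s) (Finite (f s))).
    { apply is_lim_seq_ext with (fun p => F (p + n)%nat s);
        [intros p; rewrite Nat.add_comm; reflexivity | ];
        apply (is_lim_seq_incr_n (fun p => F p s)), Hf. }
    pose proof (is_lim_seq_le _ _ _ _
      (fun p => proj1 (proj1 (Rabs_le_between _ _) (Hcauchy n p s)))
      (is_lim_seq_const _)
      (is_lim_seq_minus' _ _ _ _ Hs (is_lim_seq_const (F n s)))) as L1.
    pose proof (is_lim_seq_le _ _ _ _
      (fun p => proj2 (proj1 (Rabs_le_between _ _) (Hcauchy n p s)))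
      (is_lim_seq_minus' _ _ _ _ Hs (is_lim_seq_const (F n s)))
      (is_lim_seq_const _)) as L2.
    simpl in L1, L2. lra. }
  assert (Hfa : admissible L m f).
  { split; [ | split].
    - intros s. split.
      + apply (is_lim_seq_le (fun _ => 0) (fun n => F n s) (Finite 0) (Finite (f s)));
          [ | apply is_lim_seq_const | apply Hf].
        intros n; apply (HF n).
      + apply (is_lim_seq_le (fun n => F n s) (fun _ => m) (Finite (f s)) (Finite m));
          [ | apply Hf | apply is_lim_seq_const].
        intros n; apply (HF n).
    - intros s. apply continuity_pt_filterlim.
      apply (CVU_continuity F f s (mkposreal 1 Rlt_0_1)).
      + intros eps Heps. destruct (Hpow eps Heps) as [N HN]. exists N.
        intros n y Hn _. eapply Rle_lt_trans; [apply Hclose | apply HN, Hn].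
      + intros n y _. apply continuity_pt_filterlim, (HF n).
      + unfold Boule. rewrite Rminus_diag, Rabs_R0. simpl. lra.
    - intros s. unfold f. f_equal. apply Lim_seq_ext. intros n; apply (HF n). }
  assert (Hfix : forall s, f s = T f s).
  { intros s. apply Rminus_diag_uniq, Rabs_eq_0.
    apply Rle_antisym; [ | apply Rabs_pos]. apply Rnot_lt_le. intros Hpos.
    destruct (Hpow (Rabs (f s - T f s) / 2)) as [N HN]; [lra | ].
    pose proof (Hclose (S N) s) as C1.
    assert (C2 : Rabs (T f s - T (F N) s) <= rho * (rho ^ N * m))
      by (apply exp_average_contract; auto).
    specialize (HN (S N) ltac:(lia)). simpl in HN, C1.
    assert (C3 : Rabs (f s - T f s) <= Rabs (f s - T (F N) s) + Rabs (T f s - T (F N) s)).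
    { rewrite (Rabs_minus_sym (T f s)).
      replace (f s - T f s) with ((f s - T (F N) s) + (T (F N) s - T f s)) by ring.
      apply Rabs_triang. }
    lra. }
  exists f. split; [ | split].
  - intros s. apply is_derive_ext with (T f); [intros; symmetry; apply Hfix | ].
    refine (is_derive_eq _ _ _ _ _ (HTd f Hfa s)).
    rewrite <- Hfix. unfold euler_step. field. lra.
  - apply Hfa.
  - intros s. rewrite Hfix. pose proof (HTb f Hfa s). pose proof (Rinv_0_lt_compat l l0). lra.
Qed.

(** * Uniqueness of the bounded solution *)

(** The comparison is made in the parameter of [tau], through [h], to avoid
    inverting [h]. Dissipativity makes [E = exp (2 q0 h) (tau - f o h)^2]
    nonincreasing; going backward, [h] tends to minus infinity and, the
    difference being bounded, [E] tends to [0]. Hence [E] vanishes. *)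
Lemma bounded_solution_unique c (q f h h' tau : R -> R) q0 B :
  0 < q0 -> (forall s, q0 <= q s) ->
  (forall s, is_derive f s (1 - q s * sin_c c (f s))) ->
  (forall s, is_derive h s (h' s)) -> (forall s, 0 < h' s) ->
  (forall u, exists s, h s = u) ->
  (forall s, is_derive tau s (h' s * (1 - q (h s) * sin_c c (tau s)))) ->
  (forall s, Rabs (tau s - f (h s)) <= B) ->
  forall s, tau s = f (h s).
Proof.
  intros Hq0 Hq Hf Hh Hh' Hsurj Htau HB s.
  set (d := fun u => tau u - f (h u)).
  set (E := fun u => exp (2 * q0 * h u) * (d u * d u)).
  set (d' := fun u => - h' u * q (h u) * (sin_c c (tau u) - sin_c c (f (h u)))).
  assert (Hd : forall u, is_derive d u (d' u)).
  { intros u. refine (is_derive_eq _ _ _ _ _ (is_derive_minus tau (fun u => f (h u)) u _ _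
      (Htau u) (is_derive_Rcomp f h u _ _ (Hf (h u)) (Hh u)))).
    unfold d', minus, plus, opp; simpl. ring. }
  set (E' := fun u => 2 * exp (2 * q0 * h u) * (q0 * h' u * (d u * d u) + d u * d' u)).
  assert (HE : forall u, is_derive E u (E' u)).
  { intros u. refine (is_derive_eq _ _ _ _ _ (is_derive_Rmult
      (fun u => exp (2 * q0 * h u)) (fun u => d u * d u) u _ _
      (is_derive_Rcomp (fun x => exp (2 * q0 * x)) h u _ _
        (is_derive_exp_lin (2 * q0) (h u)) (Hh u))
      (is_derive_Rmult d d u _ _ (Hd u) (Hd u)))).
    unfold E'. ring. }
  assert (HE' : forall u, 0 <= - E' u).
  { intros u. unfold E', d'.
    pose proof (exp_pos (2 * q0 * h u)). specialize (Hq (h u)). specialize (Hh' u).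
    set (y := sin_c c (tau u) - sin_c c (f (h u))).
    assert (Hy : d u * d u <= d u * y).
    { unfold y, d. destruct (Rle_dec (f (h u)) (tau u)) as [Hle | Hle].
      - pose proof (sin_c_expand c _ _ Hle). nra.
      - pose proof (sin_c_expand c (tau u) (f (h u))). nra. }
    assert (0 <= d u * d u) by apply Rle_0_sqr.
    assert (q0 * (d u * d u) <= q (h u) * (d u * y)) by nra.
    assert (q0 * h' u * (d u * d u) + d u * (- h' u * q (h u) * y) <= 0) by nra.
    nra. }
  assert (Hmono : forall u v, u <= v -> E v <= E u).
  { intros u v Huv. cut (- E u <= - E v); [lra | ].
    apply (derive_nonneg_le (fun u => - E u) (fun u => - E' u)); auto.
    intros z. exact (is_derive_opp E z _ (HE z)). }
  assert (HEB : forall u, E u <= exp (2 * q0 * h u) * (B * B)).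
  { intros u. unfold E. apply Rmult_le_compat_l; [apply Rlt_le, exp_pos | ].
    specialize (HB u). fold (d u) in HB. apply Rabs_le_between in HB. nra. }
  assert (HE0 : E s <= 0).
  { apply Rnot_lt_le. intros Hpos.
    assert (HBB : 0 < B * B).
    { specialize (HEB s). pose proof (exp_pos (2 * q0 * h s)). nra. }
    assert (Hlt : 0 < E s / (B * B) / 2)
      by (apply Rdiv_lt_0_compat; [apply Rdiv_lt_0_compat | ]; lra).
    (* Far enough in the past, the bound on [E] is half its value at [s]. *)
    destruct (Hsurj (Rmin (h s) (ln (E s / (B * B) / 2) / (2 * q0)))) as [u Hu].
    assert (Hus : u <= s).
    { apply (derive_pos_reflects_le h h' u s Hh Hh'). rewrite Hu. apply Rmin_l. }
    pose proof (Hmono u s Hus) as H1. specialize (HEB u).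
    assert (H2 : exp (2 * q0 * h u) <= E s / (B * B) / 2).
    { rewrite <- (exp_ln _ Hlt) at 1.
      set (y := ln (E s / (B * B) / 2)) in *.
      assert (H3 : 2 * q0 * h u <= y).
      { rewrite Hu. pose proof (Rmin_r (h s) (y / (2 * q0))) as H4.
        replace y with (2 * q0 * (y / (2 * q0))) at 2 by (field; lra).
        apply Rmult_le_compat_l; lra. }
      destruct H3 as [H3 | ->]; [left; apply exp_increasing, H3 | right; reflexivity]. }
    apply (Rmult_le_compat_r (B * B)) in H2; [ | lra].
    replace (E s / (B * B) / 2 * (B * B)) with (E s / 2) in H2 by (field; nra).
    lra. }
  unfold E in HE0. pose proof (exp_pos (2 * q0 * h s)).
  assert (d s * d s <= 0) by nra. assert (d s = 0) by nra. unfold d in *. lra.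
Qed.

(** * From a solution of the radial equation to an involutoid *)

Lemma is_derive_opp_R (f : R -> R) s l : is_derive f s l -> is_derive (fun u => - f u) s (- l).
Proof. exact (is_derive_opp f s l). Qed.

Definition backward_geodesic c (eta : R -> R3) (f : R -> R) (s : R) : R3 :=
  exp_M c (eta s) (frenet_t c eta s) (- f s).

(** The Frenet frame of [eta], carried by the length [- f] and turned by [- alpha],
    has coefficients [(v, 0, w cos_c f)] with [v = w sin_c(f) / sin alpha > 0], thanks
    to the radial equation. So it is the Frenet frame of the new curve, and the
    critical point condition becomes [tan_c t = tan_c f]. *)
Lemma backward_geodesic_involutoid c eta alpha f :
  regular_curve c eta -> arc_length c eta -> 0 < alpha < PI / 2 ->
  (forall s, 0 < frenet_turning c eta s) -> smooth f -> (forall s, 0 < f s) ->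
  (forall s, is_derive f s
     (1 - cos alpha / sin alpha * frenet_turning c eta s * sin_c c (f s))) ->
  involutoid c alpha eta (backward_geodesic c eta f).
Proof.
  intros Hr Ha Halpha Hw Hfs Hf0 Hf.
  assert (Hsin : 0 < sin alpha) by (apply sin_gt_0; lra).
  set (z := backward_geodesic c eta f). set (T := frenet_t c eta) in *.
  set (w := frenet_turning c eta) in *. set (e := frenet_e c eta).
  set (W := fun s => geo_vel c (eta s) (T s) (- f s)).
  set (t := fun s => turn c (z s) (W s) (- alpha)).
  pose proof (frenet_t_unit c eta Hr) as HuT. fold T in HuT.
  assert (HuW : forall s, unit_tangent c (z s) (W s))
    by exact (fun s => unit_tangent_flow c _ _ (- f s) (HuT s)).
  assert (Hut : forall s, unit_tangent c (z s) (t s))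
    by exact (fun s => unit_tangent_turn c _ _ (- alpha) (HuW s)).
  assert (HrW : forall s, rot c (z s) (W s) = e s)
    by exact (fun s => rot_flow c (eta s) (T s) (- f s)).
  set (v := fun s => w s * sin_c c (f s) / sin alpha).
  assert (Hv : forall s, 0 < v s)
    by (intros s; apply Rdiv_lt_0_compat; [ | exact Hsin];
        apply Rmult_lt_0_compat; [apply Hw | apply sin_c_pos, Hf0]).
  assert (Hm : forall s, moving_frame c z t (fun s => rot c (z s) (t s)) s
     (v s) 0 (w s * cos_c c (f s))).
  { intros s.
    pose proof (moving_frame_turn c _ _ _ (- alpha) s _ _ _
      (moving_frame_flow c _ _ _ (fun u => - f u) _ s _ _ _
        (arc_length_moving_frame c eta Hr Ha s) (is_derive_opp_R f s _ (Hf s)))) as H.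
    fold T e w in H. cbv beta in H.
    replace (fun s => rot c (z s) (t s)) with
      (fun u => lin2 (- sin (- alpha)) (geo_vel c (eta u) (T u) (- f u)) (cos (- alpha)) (e u)).
    2:{ apply functional_extensionality; intros u. unfold t.
        rewrite (rot_turn _ _ _ _ (HuW u)), HrW. reflexivity. }
    replace t with
      (fun u => lin2 (cos (- alpha)) (geo_vel c (eta u) (T u) (- f u)) (sin (- alpha)) (e u)).
    2:{ apply functional_extensionality; intros u. unfold t, turn.
        rewrite HrW. reflexivity. }
    rewrite sin_neg, cos_neg, sin_c_opp, cos_c_opp in *.
    pose proof (sin2_cos alpha) as E.
    assert (Ea : (1 + - (1 - cos alpha / sin alpha * w s * sin_c c (f s))) * cos alpha
      + (0 * cos_c c (f s) + w s * - sin_c c (f s)) * - sin alpha = v s).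
    { unfold v. set (S := sin_c c (f s)).
      transitivity ((w s * S / sin alpha) * (cos alpha * cos alpha + sin alpha * sin alpha));
        [field; lra | rewrite E; field; lra]. }
    assert (Eb : (0 * cos_c c (f s) + w s * - sin_c c (f s)) * cos alpha
      - (1 + - (1 - cos alpha / sin alpha * w s * sin_c c (f s))) * - sin alpha = 0)
      by (field; lra).
    assert (Ew : w s * cos_c c (f s) - curvature c * 0 * - sin_c c (f s)
      = w s * cos_c c (f s)) by ring.
    rewrite Ea, Eb, Ew in H. exact H. }
  assert (Hzt : frenet_t c z = t).
  { apply functional_extensionality; intros s.
    destruct (Hm s) as (Hp & _ & _).
    apply (frenet_t_eq c z s (v s) (t s) _ (is_velocity_unique _ _ _ Hp)); [ | apply Hv].
    apply (Hut s). }
  assert (Hze : frenet_e c z = fun s => rot c (z s) (t s))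
    by (unfold frenet_e; rewrite Hzt; reflexivity).
  split.
  - split; [ | split].
    + destruct Hr as (Hsm & _).
      pose proof (smooth_comp _ _ (smooth_cos_c c) (smooth_opp _ Hfs)) as S1.
      pose proof (smooth_comp _ _ (smooth_sin_c c) (smooth_opp _ Hfs)) as S2.
      apply (smooth_curve_lin2 (fun s => cos_c c (- f s)) eta
        (fun s => sin_c c (- f s)) T S1 Hsm S2).
      unfold T. rewrite (arc_length_frenet_t c eta Ha). apply smooth_curve_velocity, Hsm.
    + intros s. apply (HuW s).
    + intros s Hs. destruct (Hm s) as (Hp & _ & _).
      apply is_velocity_unique in Hp. rewrite Hs in Hp. symmetry in Hp.
      apply (lin2_eq_0 _ _ _ _ _ (Hut s)) in Hp. specialize (Hv s). lra.
  - exists eta. split.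
    + exists f. split.
      * intros s r.
        assert (Hms := Hm s). rewrite <- Hze in Hms. rewrite <- Hzt in Hms.
        rewrite (critical_point_iff c alpha z s r (v s) (w s * cos_c c (f s)));
          [ | rewrite Hzt; exact Hut | exact Hms].
        replace (v s * sin alpha) with (w s * sin_c c (f s)) by (unfold v; field; lra).
        split.
        -- intros [_ H]. apply (tan_c_inj c).
           apply (Rmult_eq_reg_l (w s)); [ | specialize (Hw s); lra].
           rewrite <- !Rmult_assoc, (Rmult_comm (w s)), Rmult_assoc. lra.
        -- intros ->. split; [apply Rlt_le, Hf0 | ring].
      * intros s. unfold geodesic_family. rewrite Hzt, Hze.
        change (eta s = exp_M c (z s) (turn c (z s) (t s) alpha) (f s)).
        assert (Htt : turn c (z s) (t s) alpha = W s).
        { pose proof (turn_turn c _ _ (- alpha) (HuW s)) as Q.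
          rewrite Ropp_involutive in Q. exact Q. }
        rewrite Htt. rewrite <- (Ropp_involutive (f s)). symmetry.
        exact (exp_flow_back c (eta s) (T s) (- f s)).
    + exists (fun s => s). split; [apply smooth_id | ].
      split; [ | split; [intros u; exists u; reflexivity | reflexivity]].
      intros s. rewrite Derive_id. lra.
Qed.

(** * From an involutoid to a solution of the radial equation *)

Definition arcsin_c (c : space_form) (x : R) : R :=
  match c with hyperbolic => arcsinh x | euclidean => x end.

Lemma arcsin_sin_c c t : arcsin_c c (sin_c c t) = t.
Proof. destruct c; [apply arcsinh_sinh | reflexivity]. Qed.

Lemma ex_derive_arcsin_c c x : ex_derive (arcsin_c c) x.
Proof.
  destruct c; simpl.
  - eexists. apply is_derive_Reals, derivable_pt_lim_arcsinh.
  - eexists. apply (is_derive_id x).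
Qed.

(** Recovers the length of a geodesic arc from its ends and its initial
    direction. *)
Lemma inner_chord c p v t :
  unit_tangent c p v -> inner c (lin2 1 (exp_M c p v t) (-1) p) v = sin_c c t.
Proof.
  intros (Hp & Ht & Hu). change (exp_M c p v t) with (lin2 (cos_c c t) p (sin_c c t) v).
  rewrite !inner_lin2_l, Hu. destruct c; cbn [tangent cos_c sin_c] in *.
  - rewrite Ht; ring.
  - ring.
Qed.

Lemma lin2_tangent_eq a u v x y : a <> 0 -> lin2 a u 0 x = lin2 a v 0 y -> u = v.
Proof.
  intros Ha H. apply R3_eq.
  - apply (f_equal x1) in H. rewrite !x1_lin2 in H. apply (Rmult_eq_reg_l a); lra.
  - apply (f_equal x2) in H. rewrite !x2_lin2 in H. apply (Rmult_eq_reg_l a); lra.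
  - apply (f_equal x3) in H. rewrite !x3_lin2 in H. apply (Rmult_eq_reg_l a); lra.
Qed.

(** [sin_c tau] is the component along the geodesic of the chord from [zeta s] to
    [eta (h s)], and [sin_c] has a differentiable inverse. *)
Lemma contact_derivable c alpha eta zeta tau h :
  regular_curve c eta -> regular_curve c zeta -> smooth h ->
  (forall s, eta (h s) = geodesic_family c alpha zeta s (tau s)) ->
  forall s, ex_derive tau s.
Proof.
  intros Hr Hz Hh Hg s.
  set (p := zeta). set (d := fun s => turn c (p s) (frenet_t c zeta s) alpha).
  assert (Hud : forall s, unit_tangent c (p s) (d s))
    by exact (fun s => unit_tangent_turn c _ _ alpha (frenet_t_unit c zeta Hz s)).
  destruct (moving_frame_turn c _ _ _ alpha s _ _ _ (frenet_moving_frame c zeta Hz s))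
    as (Hp & Hd & _).
  pose proof (is_velocity_comp _ h s _ _
    (smooth_curve_is_velocity _ (proj1 Hr) (h s)) (smooth_is_derive h Hh s)) as He.
  assert (K : forall x : R, is_derive (fun _ : R => x) s 0)
    by (intros x; apply (is_derive_const (V := R_NormedModule))).
  pose proof (is_derive_inner c _ _ _ _ _
    (is_velocity_lin2 _ _ _ _ _ _ _ _ _ (K 1) He (K (-1)) Hp) Hd) as HS.
  destruct (ex_derive_arcsin_c c (sin_c c (tau s))) as [a Ha].
  eexists. eapply is_derive_ext;
    [ | refine (is_derive_Rcomp (arcsin_c c) _ s _ _ _ HS)].
  - intros u. cbv beta. rewrite (Hg u).
    etransitivity; [ | apply (arcsin_sin_c c)]. f_equal.
    exact (inner_chord c (p u) (d u) (tau u) (Hud u)).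
  - cbv beta. rewrite (Hg s).
    replace (inner c _ _) with (sin_c c (tau s)); [exact Ha | ].
    symmetry. exact (inner_chord c (p s) (d s) (tau s) (Hud s)).
Qed.

(** At the critical length the normal velocity of the carried frame vanishes, so
    the geodesic is tangent to [eta]. Once the direction of the tangency is
    settled, the frame of [eta o h] carried back by [- tau] is the Frenet frame of
    [zeta] turned by [alpha]. Comparing the two expressions of the velocity of
    [zeta] gives both the radial equation and the speed of [zeta]. *)
Lemma involutoid_contact c alpha eta zeta tau h :
  regular_curve c eta -> arc_length c eta -> 0 < alpha < PI / 2 ->
  regular_curve c zeta -> smooth h -> (forall s, 0 < Derive h s) ->
  (forall u, exists s, h s = u) ->
  (forall s t, critical_point c alpha zeta s t <-> t = tau s) ->
  (forall s, eta (h s) = geodesic_family c alpha zeta s (tau s)) ->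
  forall s,
    zeta s = exp_M c (eta (h s)) (frenet_t c eta (h s)) (- tau s) /\
    is_derive tau s (Derive h s *
      (1 - cos alpha / sin alpha * frenet_turning c eta (h s) * sin_c c (tau s))).
Proof.
  intros Hr Ha Halpha Hz Hh Hh' Hsurj Hcrit Hg.
  assert (Hsin : 0 < sin alpha) by (apply sin_gt_0; lra).
  assert (Hcos : 0 < cos alpha) by (apply cos_gt_0; lra).
  pose proof (contact_derivable c alpha eta zeta tau h Hr Hz Hh Hg) as Htau.
  assert (Htau' : forall s, is_derive tau s (Derive tau s))
    by (intros s; apply Derive_correct, Htau).
  pose proof (smooth_is_derive h Hh) as Hdh.
  set (t := frenet_t c zeta). set (v := speed c zeta). set (w := frenet_turning c zeta).
  set (d := fun s => turn c (zeta s) (t s) alpha).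
  set (n := fun s => rot c (zeta s) (d s)).
  set (T := frenet_t c eta). set (k := frenet_turning c eta).
  pose proof (frenet_t_unit c zeta Hz) as Hut. fold t in Hut.
  assert (Hud : forall s, unit_tangent c (zeta s) (d s))
    by exact (fun s => unit_tangent_turn c _ _ alpha (Hut s)).
  pose proof (frenet_t_unit c eta Hr) as HuT. fold T in HuT.
  pose proof (regular_speed_pos c zeta Hz) as Hv. fold v in Hv.
  assert (Hm : forall s, moving_frame c zeta d n s (v s * cos alpha) (- (v s * sin alpha)) (w s)).
  { intros s. pose proof (moving_frame_turn c _ _ _ alpha s _ _ _
      (frenet_moving_frame c zeta Hz s)) as H. fold t v w in H.
    replace (v s * cos alpha + 0 * sin alpha) with (v s * cos alpha) in H by ring.
    replace (0 * cos alpha - v s * sin alpha) with (- (v s * sin alpha)) in H by ring.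
    replace n with (fun u => lin2 (- sin alpha) (t u) (cos alpha) (frenet_e c zeta u));
      [exact H | ].
    apply functional_extensionality; intros u. symmetry. apply (rot_turn c _ _ _ (Hut u)). }
  assert (Hc : forall s, 0 <= tau s /\ w s * sin_c c (tau s) = v s * sin alpha * cos_c c (tau s)).
  { intros s. apply (critical_point_iff c alpha zeta s (tau s) (v s) (w s) Hut).
    - apply (frenet_moving_frame c zeta Hz s).
    - apply Hcrit; reflexivity. }
  set (g := fun s => geo_vel c (zeta s) (d s) (tau s)).
  assert (Hgam : forall s, eta (h s) = exp_M c (zeta s) (d s) (tau s)) by exact Hg.
  assert (Hug : forall s, unit_tangent c (eta (h s)) (g s)).
  { intros s. rewrite Hgam. exact (unit_tangent_flow c _ _ (tau s) (Hud s)). }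
  set (A := fun s => v s * cos alpha + Derive tau s).
  assert (Hmg : forall s, moving_frame c (fun u => eta (h u)) g n s (A s) 0
     (w s * cos_c c (tau s) - curvature c * - (v s * sin alpha) * sin_c c (tau s))).
  { intros s. pose proof (moving_frame_flow c _ _ _ tau _ s _ _ _ (Hm s) (Htau' s)) as H.
    replace (- (v s * sin alpha) * cos_c c (tau s) + w s * sin_c c (tau s)) with 0 in H
      by (destruct (Hc s) as [_ ->]; ring).
    replace (fun u => eta (h u)) with (fun u => exp_M c (zeta u) (d u) (tau u));
      [exact H | ].
    apply functional_extensionality; intros u; symmetry; apply Hgam. }
  assert (Hmh : forall s, moving_frame c (fun u => eta (h u)) (fun u => T (h u))
     (fun u => frenet_e c eta (h u)) s (Derive h s * 1) (Derive h s * 0) (Derive h s * k (h s)))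
    by exact (fun s => moving_frame_comp c _ _ _ h _ s _ _ _
      (arc_length_moving_frame c eta Hr Ha (h s)) (Hdh s)).
  assert (HAT : forall s, lin2 (A s) (g s) 0 (n s) = lin2 (Derive h s) (T (h s)) 0 (n s)).
  { intros s. destruct (Hmg s) as (H1 & _ & _), (Hmh s) as (H2 & _ & _).
    apply is_velocity_unique in H1. apply is_velocity_unique in H2.
    rewrite <- H1, H2. apply R3_eq; coords; ring. }
  set (X := fun s => inner c (g s) (T (h s))).
  assert (HX : forall s, A s = Derive h s * X s /\ A s * X s = Derive h s).
  { intros s. pose proof (HAT s) as H. split.
    - apply (f_equal (fun x => inner c x (g s))) in H.
      destruct (Hug s) as (_ & _ & H1). rewrite !inner_lin2_l, H1 in H.
      unfold X. rewrite (inner_sym c (g s)). lra.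
    - apply (f_equal (fun x => inner c x (T (h s)))) in H.
      destruct (HuT (h s)) as (_ & _ & H1). rewrite !inner_lin2_l, H1 in H.
      unfold X. lra. }
  assert (HX1 : forall s, X s * X s = 1).
  { intros s. destruct (HX s) as [H1 H2]. rewrite H1 in H2. specialize (Hh' s).
    apply (Rmult_eq_reg_l (Derive h s)); lra. }
  (* [X ^ 2 = 1] forces [X X' = 0]: the direction of contact does not change. *)
  assert (HX0 : forall s, is_derive X s 0).
  { intros s. destruct (Hmg s) as (_ & H1 & _), (Hmh s) as (_ & H2 & _).
    pose proof (is_derive_inner c _ _ _ _ _ H1 H2) as H. fold X in H.
    match type of H with is_derive _ _ ?l => set (D := l) in * end.
    assert (E : D * X s + X s * D = 0).
    { pose proof (is_derive_Rmult X X s _ _ H H) as H3.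
      apply is_derive_unique in H3. rewrite <- H3.
      apply is_derive_unique, is_derive_ext with (fun _ => 1).
      - intros u. symmetry. apply HX1.
      - apply (is_derive_const (V := R_NormedModule)). }
    refine (is_derive_eq _ _ _ _ _ H). specialize (HX1 s). nra. }
  assert (HXc : forall s, X s = X 0) by (intros s; apply derive_0_const, HX0).
  (* Opposite directions would give [(tau + h)' = - v cos alpha < 0]. *)
  assert (HXpos : X 0 = 1).
  { pose proof (HX1 0) as HX10.
    destruct (Rle_dec 0 (X 0)) as [Hle | Hneg]; [nra | exfalso].
    assert (HXm : X 0 = -1) by nra.
    destruct (Hsurj (h 0 + tau 0 + 1)) as [s1 Hs1].
    assert (H0 : 0 <= s1).
    { apply (derive_pos_reflects_le h (Derive h)); auto.
      destruct (Hc 0) as [Ht0 _]. lra. }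
    assert (Hdec : - (tau 0 + h 0) <= - (tau s1 + h s1)).
    { apply (derive_nonneg_le (fun u => - (tau u + h u))
        (fun u => - (Derive tau u + Derive h u))).
      - intros z. apply (is_derive_opp (fun u => tau u + h u)).
        apply (is_derive_plus tau h); auto.
      - intros z. destruct (HX z) as [HA _]. rewrite HXc, HXm in HA. unfold A in HA.
        specialize (Hv z). nra.
      - lra. }
    destruct (Hc s1) as [Ht1 _]. lra. }
  assert (Hgt : forall s, g s = T (h s)).
  { intros s. pose proof (HAT s) as H. destruct (HX s) as [HA _].
    rewrite HXc, HXpos, Rmult_1_r in HA. rewrite HA in H.
    specialize (Hh' s). apply (lin2_tangent_eq _ _ _ _ _ (Rgt_not_eq _ _ Hh') H). }
  assert (Hzeta : forall s, zeta s = exp_M c (eta (h s)) (T (h s)) (- tau s)).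
  { intros s. rewrite <- Hgt, Hgam. symmetry. apply exp_flow_back. }
  intros s. split; [apply Hzeta | ].
  pose proof (moving_frame_flow c _ _ _ (fun u => - tau u) _ s _ _ _ (Hmh s)
    (is_derive_opp_R tau s _ (Htau' s))) as (H1 & _ & _).
  cbv beta in H1.
  replace (fun u => exp_M c (eta (h u)) (T (h u)) (- tau u)) with zeta in H1
    by (apply functional_extensionality; exact Hzeta).
  destruct (Hm s) as (H2 & _ & _).
  apply is_velocity_unique in H1. apply is_velocity_unique in H2. rewrite H1 in H2.
  assert (Hd : geo_vel c (eta (h s)) (T (h s)) (- tau s) = d s).
  { rewrite <- Hgt, Hgam. apply geo_vel_flow_back. }
  assert (Hn : frenet_e c eta (h s) = n s).
  { unfold frenet_e. fold T. rewrite <- Hgt, Hgam. apply rot_flow. }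
  rewrite Hd, Hn in H2. apply (lin2_inj c _ _ _ _ _ _ (Hud s)) in H2.
  destruct H2 as [E1 E2]. rewrite sin_c_opp in E2.
  refine (is_derive_eq _ _ _ _ _ (Htau' s)). fold k.
  assert (E3 : v s = Derive h s * k (h s) * sin_c c (tau s) / sin alpha).
  { apply (Rmult_eq_reg_r (sin alpha)); [ | lra].
    transitivity (Derive h s * k (h s) * sin_c c (tau s)); [lra | field; lra]. }
  rewrite E3 in E1.
  transitivity (Derive h s - Derive h s * k (h s) * sin_c c (tau s) / sin alpha * cos alpha);
    [lra | field; lra].
Qed.

(** * Existence and uniqueness of the closed involutoid *)

Theorem theorem6 (c : space_form) (eta : R -> R3) (heta : convex_curve c eta)
    (alpha : R) (halpha : 0 < alpha < PI / 2) :
  exists zeta : R -> R3,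
    (closed_curve zeta /\ involutoid c alpha eta zeta) /\
    (forall zeta' : R -> R3,
       closed_curve zeta' /\ involutoid c alpha eta zeta' ->
       reparametrization zeta' zeta).
Proof.
  destruct heta as (Hsm & HM & (L & HL & Hper) & Ha & k & Hk & Hkpos).
  pose proof (arc_length_regular c eta Hsm HM Ha) as Hr.
  assert (Hsin : 0 < sin alpha) by (apply sin_gt_0; lra).
  assert (Hcos : 0 < cos alpha) by (apply cos_gt_0; lra).
  assert (Hw : forall s, 0 < frenet_turning c eta s).
  { intros s. rewrite <- (geodesic_curvature_eq c eta k Hr Ha Hk s).
    specialize (Hkpos s). destruct c; simpl in Hkpos; lra. }
  set (q := fun s => cos alpha / sin alpha * frenet_turning c eta s).
  assert (Hpt : forall s, frenet_t c eta (s + L) = frenet_t c eta s)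
    by (rewrite (arc_length_frenet_t c eta Ha); apply velocity_periodic, Hper).
  assert (Hqs : smooth q).
  { apply smooth_mult; [apply smooth_const | ]. unfold frenet_turning, frenet_e.
    rewrite (arc_length_frenet_t c eta Ha).
    pose proof (smooth_curve_velocity eta Hsm) as Hv.
    exact (smooth_inner c _ _ (smooth_curve_velocity _ Hv)
      (smooth_curve_rot c eta (velocity eta) Hsm Hv)). }
  assert (Hqp : forall s, q (s + L) = q s).
  { intros s. unfold q, frenet_turning, frenet_e.
    rewrite (velocity_periodic (frenet_t c eta) L Hpt), Hper, Hpt. reflexivity. }
  assert (Hqc : forall s, continuous q s)
    by (intros s; apply (ex_derive_continuous q), (Hqs 1%nat)).
  destruct (periodic_bounded q L HL Hqp Hqc) as [[b Hb] [a Hq0]].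
  assert (Hqa : 0 < q a)
    by (apply Rmult_lt_0_compat; [apply Rdiv_lt_0_compat; assumption | apply Hw]).
  destruct (exists_periodic_solution c q L (q a) (q b) HL Hqa
    (fun s => conj (Hq0 s) (Hb s)) Hqc Hqp) as (f & Hf & Hfp & Hf0).
  pose proof (smooth_ode c q f Hqs Hf) as Hfs.
  exists (backward_geodesic c eta f). split; [split | ].
  - exists L. split; [exact HL | ]. intros s. unfold backward_geodesic.
    rewrite Hper, Hpt, Hfp. reflexivity.
  - apply backward_geodesic_involutoid; auto.
  - intros zeta' [(L' & HL' & Hper') (Hz & gamma & (tau & Hcrit & Hgam) & h & Hh & Hh' & Hsurj & Hgh)].
    assert (Hg : forall s, eta (h s) = geodesic_family c alpha zeta' s (tau s))
      by (intros s; rewrite <- Hgh; apply Hgam).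
    pose proof (involutoid_contact c alpha eta zeta' tau h Hr Ha halpha Hz Hh Hh' Hsurj
      Hcrit Hg) as Hcont.
    (* Periodicity of [zeta'] passes to its unique critical length, which is
       therefore bounded. *)
    assert (Htp : forall s, tau (s + L') = tau s).
    { intros s. apply Hcrit.
      assert (Hfam : forall u t, geodesic_family c alpha zeta' (u + L') t
        = geodesic_family c alpha zeta' u t).
      { intros u t. unfold geodesic_family, frenet_e, frenet_t.
        rewrite (velocity_periodic zeta' L' Hper'), Hper'. reflexivity. }
      destruct (proj2 (Hcrit (s + L') (tau (s + L'))) eq_refl) as (H0 & x & y & Hxy & E).
      split; [exact H0 | ]. exists x, y. split; [exact Hxy | ].
      rewrite <- E. f_equal; f_equal.
      - symmetry. apply (velocity_periodic
          (fun u => geodesic_family c alpha zeta' u (tau (s + L'))) L').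
        intros u; apply Hfam.
      - f_equal. apply functional_extensionality; intros u. symmetry; apply Hfam. }
    assert (Htc : forall s, continuous tau s).
    { intros s. apply (ex_derive_continuous tau). eexists; apply (Hcont s). }
    assert (Hfc : forall s, continuous f s).
    { intros s. apply (ex_derive_continuous f). eexists; apply Hf. }
    destruct (periodic_bounded tau L' HL' Htp Htc) as [[u1 Hu1] [u2 Hu2]].
    destruct (periodic_bounded f L HL Hfp Hfc) as [[v1 Hv1] [v2 Hv2]].
    exists h. split; [exact Hh | split; [exact Hh' | split; [exact Hsurj | ]]].
    intros s. unfold backward_geodesic.
    rewrite <- (bounded_solution_unique c q f h (Derive h) tau (q a)
      (Rabs (tau u1) + Rabs (tau u2) + Rabs (f v1) + Rabs (f v2))); auto.
    + apply Hcont.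
    + apply smooth_is_derive, Hh.
    + apply Hcont.
    + intros r. specialize (Hu1 r). specialize (Hu2 r).
      specialize (Hv1 (h r)). specialize (Hv2 (h r)).
      pose proof (Rle_abs (tau u1)). pose proof (Rle_abs (- tau u2)).
      pose proof (Rle_abs (f v1)). pose proof (Rle_abs (- f v2)).
      rewrite Rabs_Ropp in *.
      pose proof (Rabs_pos (tau u1)). pose proof (Rabs_pos (tau u2)).
      pose proof (Rabs_pos (f v1)). pose proof (Rabs_pos (f v2)).
      apply Rabs_le. lra.
Qed.
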